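(* Let $N\ge1$ be an integer and $\alpha>0$. Let $\varphi\in L^1_{\rm loc}(\mathbb R^N)$, $\varphi\ge0$, and suppose that $\varphi(x)\ge\omega(x)|x|^{-\gamma}$ for $|x|\ge R$, for some $R>0$, where $\omega\in L^\infty(\mathbb R^N)$ is homogeneous of degree $0$, $\omega\ge0$ and $\omega\not\equiv0$. If $0<\gamma<N$ and $\gamma<\frac2\alpha$, then, for the equation $\partial_tu=\Delta u+|u|^\alpha u$ on $\mathbb R^N$ with $u(0)=\lambda\varphi$, one has $T_{\max}(\lambda\varphi)<\infty$ for all $\lambda>0$ and $$\limsup_{\lambda\to0}\lambda^{\left(\frac1\alpha-\frac\gamma2\right)^{-1}}T_{\max}(\lambda\varphi)\ \le\ \frac{1}{\left(\alpha^{1/\alpha}\left\|e^{\Delta}(\omega|\cdot|^{-\gamma})\right\|_\infty\right)^{\left(\frac1\alpha-\frac\gamma2\right)^{-1}}} .$$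
   Context: $e^{t\Delta}$ is the heat semigroup on $\mathbb R^N$ (convolution with $G_t(x)=(4\pi t)^{-N/2}e^{-|x|^2/4t}$), and $e^\Delta$ is its value at $t=1$. For $u_0\ge0$ locally integrable, $T_{\max}(u_0)\in[0,\infty]$ is the maximal existence time of a nonnegative solution of $u(t)=e^{t\Delta}u_0+\int_0^te^{(t-\sigma)\Delta}[|u(\sigma)|^\alpha u(\sigma)]\,d\sigma$, i.e. the supremum of the $T>0$ for which there is a nonnegative, a.e. finite measurable function $u$ on $(0,T)\times\mathbb R^N$ satisfying this equation ($T_{\max}(u_0)=0$ if there is no such $T$). *)

(* Defs.v *)
From HB Require Import structures.
From mathcomp Require Import all_boot all_order all_algebra.
From mathcomp Require Import all_classical all_reals all_analysis.
From mathcomp Require Import measurable_realfun ess_sup_inf.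

Set Implicit Arguments.
Unset Strict Implicit.
Unset Printing Implicit Defensive.
Import Order.TTheory GRing.Theory Num.Theory.
Import numFieldNormedType.Exports.

Local Open Scope classical_set_scope.
Local Open Scope ring_scope.

(* R^n is 'rV[R]_n, with the product (i.e. Borel) sigma-algebra. *)
Section measurable_rV.
Context {R : realType} {n : nat}.

Let coord (i : 'I_n) (x : 'rV[R]_n) : R := x ord0 i.

Let rV_set0 : g_sigma_preimage coord set0.
Proof. exact: sigma_algebra0. Qed.

Let rV_setC A : g_sigma_preimage coord A -> g_sigma_preimage coord (~` A).
Proof. exact: sigma_algebraC. Qed.

Let rV_bigcup (F : (set 'rV[R]_n)^nat) :
  (forall i, g_sigma_preimage coord (F i)) ->
  g_sigma_preimage coord (\bigcup_i (F i)).
Proof. exact: sigma_algebra_bigcup. Qed.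

HB.instance Definition _ := @isMeasurable.Build default_measure_display
  'rV[R]_n (g_sigma_preimage coord) rV_set0 rV_setC rV_bigcup.

Lemma measurable_coord (i : 'I_n) :
  measurable_fun [set: 'rV[R]_n] (fun x : 'rV[R]_n => x ord0 i).
Proof.
move=> _ Y mY; rewrite setTI; apply: sub_sigma_algebra => /=.
rewrite -bigcup_seq/=; exists i => /=; first by rewrite mem_index_enum.
by exists Y => //; rewrite setTI.
Qed.

Lemma measurable_fun_rVP d (T : measurableType d) (f : T -> 'rV[R]_n) :
  (forall i, measurable_fun [set: T] (fun t => f t ord0 i)) ->
  measurable_fun [set: T] f.
Proof.
move=> mf _ A mA; rewrite setTI.
have : preimage_set_system [set: T] f (g_sigma_preimage coord) (f @^-1` A).
  by exists A => //; rewrite setTI.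
rewrite -g_sigma_preimage_comp; apply: smallest_sub.
  exact: sigma_algebra_measurable.
rewrite -bigcup_seq; apply: bigcup_sub => i _ B [C mC <-].
exact: mf.
Qed.

End measurable_rV.

Section lebesgue_rV.
Context {R : realType}.

Definition rV_cons n (p : R * 'rV[R]_n) : 'rV[R]_n.+1 :=
  row_mx p.1%:M p.2 : 'rV[R]_(1 + n).

Definition rV_uncons n (x : 'rV[R]_n.+1) : R * 'rV[R]_n :=
  (x ord0 ord0, @rsubmx R 1 1 n x).

Lemma rV_consK n : cancel (@rV_cons n) (@rV_uncons n).
Proof.
case=> a v; rewrite /rV_uncons /rV_cons /=; congr (_, _).
  transitivity ((row_mx a%:M v : 'rV[R]_(1 + n)) ord0 (lshift n ord0)).
    by congr (fun_of_matrix _ _ _); exact: val_inj.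
  by rewrite row_mxEl mxE eqxx.
exact: row_mxKr.
Qed.

Lemma rV_cons0 n a (v : 'rV[R]_n) : rV_cons (a, v) ord0 ord0 = a.
Proof. by have /(congr1 fst) := rV_consK (a, v). Qed.

Lemma rV_consS n a (v : 'rV[R]_n) i :
  rV_cons (a, v) ord0 (lift ord0 i) = v ord0 i.
Proof. by rewrite -rshift1; exact: row_mxEr. Qed.

Lemma measurable_rV_cons n : measurable_fun setT (@rV_cons n).
Proof.
apply: measurable_fun_rVP => i.
have [j ->|->] := unliftP ord0 i.
  rewrite (_ : (fun _ => _) =
    (fun x : 'rV[R]_n => x ord0 j) \o snd); last first.
    by apply/funext => -[a v]; rewrite rV_consS.
  by apply: measurableT_comp => //; exact: measurable_coord.
rewrite (_ : (fun _ => _) = fst) //.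
by apply/funext => -[a v]; rewrite rV_cons0.
Qed.

Lemma measurable_rV_uncons n : measurable_fun setT (@rV_uncons n).
Proof.
apply: measurable_fun_pair; first exact: measurable_coord.
apply: measurable_fun_rVP => i.
rewrite (_ : (fun _ => _) = fun x : 'rV[R]_n.+1 => x ord0 (lift ord0 i)).
  exact: measurable_coord.
by apply/funext => x; rewrite mxE rshift1.
Qed.

Section lebesgue_cons.
Variables (n : nat) (mu : {sigma_finite_measure set 'rV[R]_n -> \bar R}).

Definition lebesgue_cons : set 'rV[R]_n.+1 -> \bar R :=
  pushforward (@lebesgue_measure R \x mu)%E (@rV_cons n).

Let mcons A : measurable A -> measurable (@rV_cons n @^-1` A).
Proof. by move=> mA; rewrite -[X in measurable X]setTI; exact: measurable_rV_cons. Qed.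

Let lebesgue_cons0 : lebesgue_cons set0 = 0%E.
Proof. by rewrite /lebesgue_cons /pushforward preimage_set0 measure0. Qed.

Let lebesgue_cons_ge0 A : (0 <= lebesgue_cons A)%E.
Proof. by rewrite /lebesgue_cons /pushforward; exact: measure_ge0. Qed.

Let lebesgue_cons_sigma_additive : semi_sigma_additive lebesgue_cons.
Proof.
move=> F mF tF mUF; rewrite /lebesgue_cons /pushforward preimage_bigcup.
apply: measure_semi_sigma_additive.
- by move=> k; exact: mcons.
- apply/trivIsetP => /= i j _ _ ij; rewrite -preimage_setI.
  by move/trivIsetP : tF => /(_ _ _ _ _ ij) ->//; rewrite preimage_set0.
- by rewrite -preimage_bigcup; exact: mcons.
Qed.

HB.instance Definition _ := isMeasure.Build _ _ _ lebesgue_cons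
  lebesgue_cons0 lebesgue_cons_ge0 lebesgue_cons_sigma_additive.

Let lebesgue_cons_sigma_finite : sigma_finite setT lebesgue_cons.
Proof.
have [F FT Foo] : sigma_finite setT (@lebesgue_measure R \x mu)%E.
  have /sigma_finiteP[F [TF ndF Foo]] := sigma_finiteT (@lebesgue_measure R).
  have /sigma_finiteP[G [TG ndG Goo]] := sigma_finiteT mu.
  exists (fun k => F k `*` G k).
    rewrite -setXTT TF TG predeqE => -[x y]; split.
      move=> [/= [i _ Fix] [k _ Gky]]; exists (maxn i k) => //; split.
      - by move: x Fix; exact/subsetPset/ndF/leq_maxl.
      - by move: y Gky; exact/subsetPset/ndG/leq_maxr.
    by move=> [i _ []/= ? ?]; split; exists i.
  move=> k; have [? ?] := Foo k; have [? ?] := Goo k.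
  split; first exact: measurableX.
  by rewrite product_measure1E// lte_mul_pinfty// ge0_fin_numE.
exists (fun k => @rV_uncons n @^-1` F k).
  by rewrite -preimage_bigcup -FT preimage_setT.
move=> k; have [mFk Fkoo] := Foo k; split.
  by rewrite -[X in measurable X]setTI; exact: measurable_rV_uncons.
rewrite /lebesgue_cons /pushforward -comp_preimage.
by rewrite (_ : _ \o _ = id)//; apply/funext; exact: rV_consK.
Qed.

HB.instance Definition _ := Measure_isSigmaFinite.Build _ _ _ lebesgue_cons
  lebesgue_cons_sigma_finite.

End lebesgue_cons.

(* The n-dimensional Lebesgue measure, as an iterated product measure. *)
Fixpoint lebesgue_rV (n : nat) : {sigma_finite_measure set 'rV[R]_n -> \bar R} :=
  match n with
  | 0 => @dirac _ 'rV[R]_0 0 R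
  | m.+1 => lebesgue_cons (lebesgue_rV m)
  end.

Lemma lebesgue_rV_box n (A : 'I_n -> set R) : (forall i, measurable (A i)) ->
  lebesgue_rV n [set x | forall i, A i (x ord0 i)] =
  (\prod_(i < n) lebesgue_measure (A i))%E.
Proof.
elim: n A => [|n IH] A mA.
  rewrite big_ord0 /= /dirac indicE mem_set//=.
  by case.
rewrite big_ord_recl -IH//= /lebesgue_cons /pushforward.
rewrite -product_measure1E//.
- congr (product_measure1 _ _ _); apply/seteqP; split => -[a v] /=.
    move=> h; split; first by have := h ord0; rewrite rV_cons0.
    by move=> i; have := h (lift ord0 i); rewrite rV_consS.
  move=> [h0 h] i; have [j ->|->] := unliftP ord0 i; first by rewrite rV_consS.
  by rewrite rV_cons0.
- exact: mA.
- rewrite [X in measurable X](_ : _ = \bigcap_(i in [set: 'I_n])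
      ((fun x : 'rV[R]_n => x ord0 i) @^-1` A (lift ord0 i))); last first.
    by apply/seteqP; split => x /= h i => [_|]; exact: h.
  apply: fin_bigcap_measurable => // i _.
  by rewrite -[X in measurable X]setTI; exact: measurable_coord.
Qed.

End lebesgue_rV.

Section heat.
Context {R : realType} {N : nat}.
Local Notation mu := (@lebesgue_rV R N).

(* The norm of the library on 'rV[R]_N is the sup norm. *)
Definition enorm (x : 'rV[R]_N) : R := Num.sqrt (\sum_(i < N) x ord0 i ^+ 2).

Definition heat_kernel (t : R) (x : 'rV[R]_N) : R :=
  (4 * pi * t) `^ (- (N%:R / 2)) * expR (- (enorm x ^+ 2 / (4 * t))).

Definition heat (t : R) (f : 'rV[R]_N -> \bar R) (x : 'rV[R]_N) : \bar R :=
  (\int[mu]_y ((heat_kernel t (x - y))%:E * f y))%E.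

(* Same shape as the one-dimensional [locally_integrable] of the library. *)
Definition locally_integrable_rV (f : 'rV[R]_N -> R) : Prop :=
  measurable_fun [set: 'rV[R]_N] f /\
  forall K : set 'rV[R]_N, compact K -> (\int[mu]_(x in K) `|f x|%:E < +oo)%E.

(* For each c the identity is required almost everywhere, so that it makes
   sense for an element of L^oo. *)
Definition homogeneous0 (w : 'rV[R]_N -> R) : Prop :=
  forall c : R, 0 < c -> \forall x \ae mu, w (c *: x) = w x.

(* A nonnegative, a.e. finite measurable u : (0,T) x R^N -> [0,+oo] is a
   solution if the integral equation holds a.e. in (0,T) x R^N; both sides are
   well defined in [0,+oo]. *)
Definition is_solution (alpha : R) (u0 : 'rV[R]_N -> R) (T : R)
    (u : R -> 'rV[R]_N -> \bar R) : Prop :=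
  let nu := (@lebesgue_measure R \x mu)%E in
  [/\ measurable_fun (`]0, T[ `*` [set: 'rV[R]_N])
        (fun p : R * 'rV[R]_N => u p.1 p.2),
      forall t x, 0 < t < T -> (0 <= u t x)%E,
      \forall p \ae nu, 0 < p.1 < T -> u p.1 p.2 \is a fin_num &
      \forall p \ae nu, 0 < p.1 < T ->
        u p.1 p.2 = (heat p.1 (EFin \o u0) p.2 +
          \int[@lebesgue_measure R]_(s in `]0%R, p.1[)
            heat (p.1 - s)%R (fun y => `|u s y| `^ alpha * u s y) p.2)%E].

(* 0 is adjoined so that Tmax is 0, and not -oo, when there is no solution. *)
Definition Tmax (alpha : R) (u0 : 'rV[R]_N -> R) : \bar R :=
  ereal_sup (0%E |` [set T%:E | T in [set T : R |
    0 < T /\ exists u, is_solution alpha u0 T u]]).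

End heat.

(* Main.v *)
(* If u is a solution on (0,T), then for almost every (t,x) the function
   h(s) = (e^((t-s)Delta) u(s))(x) satisfies
   h(s) = h(0) + int_0^s (e^((t-r)Delta) u(r)^(1+alpha))(x) dr, and by Jensen
   the integrand is at least h(r)^(1+alpha). As h stays bounded by
   u(t,x) < +oo up to time t, comparison with y' = y^(1+alpha) yields
   alpha t (e^(t Delta) u(0) (x))^alpha <= 1 for almost every (t,x).
   For u(0) = lambda phi, the lower bound on phi and the homogeneity of omega
   give, after parabolic scaling,
   e^(t Delta) phi (sqrt t x) >= t^(-gamma/2) (e^Delta f_c)(x)
   as soon as c sqrt t >= rho, where f_c is omega |.|^(-gamma) cut off on
   |x| < c. When c decreases to 0, e^Delta f_c increases to
   e^Delta (omega |.|^(-gamma)), so every m below the sup norm of the latter is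
   exceeded on a set of positive measure for some c; hence
   Tmax(lambda phi) <= max((rho/c)^2, (alpha^(1/alpha) lambda m)^(-beta)). *)

Require Import Defs.
From HB Require Import structures.
From mathcomp Require Import all_boot all_order all_algebra.
From mathcomp Require Import all_classical all_reals all_analysis.
From mathcomp Require Import measurable_realfun ess_sup_inf.
From mathcomp Require Import ring lra.

Set Implicit Arguments.
Unset Strict Implicit.
Unset Printing Implicit Defensive.
Import Order.TTheory GRing.Theory Num.Theory.
Import numFieldNormedType.Exports.

Local Open Scope classical_set_scope.
Local Open Scope ring_scope.

(** * Measurability of the heat kernel and of the heat flow; splitting off one coordinate *)

Section measurability.
Context {R : realType}.

(** Inversion is discontinuous at 0, so it is written piecewise through power functions; at 0 both
    sides take the default value 0. *)
Lemma measurable_invr : measurable_fun [set: R] (@GRing.inv R).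
Proof.
rewrite (_ : @GRing.inv R =
  fun x => if 0 < x then x `^ (-1) else - ((- x) `^ (-1))).
  apply: measurable_fun_ifT.
  - exact: measurable_fun_ltr.
  - exact: measurable_powR.
  - apply: measurableT_comp => //.
    exact: (measurableT_comp (measurable_powR (-1))).
apply/funext => x; case: ltP => [x0|x0].
  by rewrite powR_inv1// ltW.
by rewrite powR_inv1 ?oppr_ge0// invrN opprK.
Qed.

Lemma measurable_rVB d (T : measurableType d) n (f g : T -> 'rV[R]_n) :
  measurable_fun [set: T] f -> measurable_fun [set: T] g ->
  measurable_fun [set: T] (fun t => f t - g t).
Proof.
move=> mf mg; apply: measurable_fun_rVP => i.
rewrite (_ : (fun _ => _) = fun t => f t ord0 i - g t ord0 i); last first.
  by apply/funext => t; rewrite !mxE.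
apply: measurable_funB.
  exact: (measurableT_comp (measurable_coord i) mf).
exact: (measurableT_comp (measurable_coord i) mg).
Qed.

Lemma measurable_rVZ n (c : R) :
  measurable_fun [set: 'rV[R]_n] (fun x : 'rV[R]_n => c *: x).
Proof.
apply: measurable_fun_rVP => i.
rewrite (_ : (fun _ => _) = fun t : 'rV[R]_n => c * t ord0 i); last first.
  by apply/funext => t; rewrite !mxE.
by apply: measurable_funM => //; exact: measurable_coord.
Qed.

Lemma measurable_enorm n : measurable_fun [set: 'rV[R]_n] (@enorm R n).
Proof.
rewrite /enorm.
apply: (@measurableT_comp _ _ _ _ _ _ (@Num.sqrt R)).
  exact: (continuous_measurable_fun (@sqrt_continuous R)).
apply: measurable_sum => i.
by apply: measurable_funX; exact: measurable_coord.
Qed.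

Lemma measurable_heat_kernel d (T : measurableType d) n (tau : T -> R)
    (X : T -> 'rV[R]_n) :
  measurable_fun [set: T] tau -> measurable_fun [set: T] X ->
  measurable_fun [set: T] (fun w => heat_kernel (tau w) (X w)).
Proof.
move=> mtau mX; apply: measurable_funM.
  apply: (measurableT_comp (measurable_powR _)).
  by apply: measurable_funM.
apply: measurableT_comp => //; apply: measurableT_comp => //.
apply: measurable_funM.
  by apply: measurable_funX; exact: (measurableT_comp (@measurable_enorm n) mX).
apply: (measurableT_comp measurable_invr).
by apply: measurable_funM.
Qed.

Lemma heat_kernel_ge0 n t (x : 'rV[R]_n) : 0 <= heat_kernel t x.
Proof. by rewrite mulr_ge0 ?powR_ge0 ?expR_ge0. Qed.

Lemma heat_kernel_gt0 n t (x : 'rV[R]_n) : 0 < t -> 0 < heat_kernel t x.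
Proof.
by move=> t0; rewrite mulr_gt0 ?expR_gt0// powR_gt0// !mulr_gt0 ?pi_gt0.
Qed.

Lemma heat_ge0 n t (f : 'rV[R]_n -> \bar R) x :
  (forall y, 0 <= f y)%E -> (0 <= heat t f x)%E.
Proof.
move=> f0; apply: integral_ge0 => y _.
by rewrite mule_ge0// lee_fin heat_kernel_ge0.
Qed.

Lemma measurable_heat_integrand n t (f : 'rV[R]_n -> \bar R) x :
  measurable_fun [set: 'rV[R]_n] f ->
  measurable_fun [set: 'rV[R]_n] (fun y => (heat_kernel t (x - y))%:E * f y)%E.
Proof.
move=> mf; apply: emeasurable_funM => //; apply/measurable_EFinP.
by apply: measurable_heat_kernel => //; exact: measurable_rVB.
Qed.

(** Time, point and function all vary with the parameter, because the Duhamel integrand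
    [heat (s - r) (P r) y] must be jointly measurable in [r] and [y]. This is the measurability part
    of Tonelli's theorem. *)
Lemma measurable_heat d (T : measurableType d) n (tau : T -> R)
    (X : T -> 'rV[R]_n) (P : T -> 'rV[R]_n -> \bar R) :
  measurable_fun [set: T] tau -> measurable_fun [set: T] X ->
  (forall w y, 0 <= P w y)%E ->
  measurable_fun [set: T * 'rV[R]_n] (fun p : T * 'rV[R]_n => P p.1 p.2) ->
  measurable_fun [set: T] (fun w => heat (tau w) (P w) (X w)).
Proof.
move=> mtau mX P0 mP.
apply: (@measurable_fun_fubini_tonelli_F _ _ T 'rV[R]_n R (lebesgue_rV n)
  (fun p : T * 'rV[R]_n => (heat_kernel (tau p.1) (X p.1 - p.2))%:E * P p.1 p.2)%E).
  apply: emeasurable_funM => //; apply/measurable_EFinP.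
  apply: measurable_heat_kernel; first exact: measurableT_comp.
  apply: measurable_rVB; last exact: measurable_snd.
  by apply: measurableT_comp.
by move=> p; rewrite mule_ge0// lee_fin heat_kernel_ge0.
Qed.

Lemma measurable_heatr n t (f : 'rV[R]_n -> \bar R) :
  measurable_fun [set: 'rV[R]_n] f -> (forall y, 0 <= f y)%E ->
  measurable_fun [set: 'rV[R]_n] (heat t f).
Proof.
move=> mf f0; apply: (@measurable_heat _ _ n (cst t) id (cst f)) => //.
exact: measurableT_comp.
Qed.

(** The measure in dimension n + 1 is the pushforward of a product, so Tonelli's theorem applies.
    The inductions on the dimension rest on this. *)
Lemma integral_rV_cons n (f : 'rV[R]_n.+1 -> \bar R) :
  measurable_fun [set: 'rV[R]_n.+1] f -> (forall x, 0 <= f x)%E ->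
  (\int[lebesgue_rV n.+1]_x f x =
   \int[@lebesgue_measure R]_a \int[lebesgue_rV n]_v f (rV_cons (a, v)))%E.
Proof.
move=> mf f0.
have mc : measurable_fun [set: (measurableTypeR R * 'rV[R]_n)%type] (@rV_cons R n).
  exact: measurable_rV_cons.
transitivity (\int[(@lebesgue_measure R \x lebesgue_rV n)%E]_p f (rV_cons p))%E.
  have := @ge0_integral_pushforward _ _ (measurableTypeR R * 'rV[R]_n)%type _ R
    _ mc (@lebesgue_measure R \x lebesgue_rV n)%E _ f
    measurableT mf (fun y _ => f0 y).
  by rewrite preimage_setT; apply.
apply: (@fubini_tonelli1 _ _ _ _ _ (@lebesgue_measure R) (lebesgue_rV n)
  (f \o @rV_cons R n)).
- exact: measurableT_comp.
- by move=> x; exact: f0.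
Qed.

Lemma rV_unconsK n : cancel (@rV_uncons R n) (@rV_cons R n).
Proof.
move=> x; apply/rowP => i; have [j ->|->] := unliftP ord0 i.
  by rewrite rV_consS /rV_uncons mxE rshift1.
by rewrite rV_cons0.
Qed.

End measurability.

(** * Mass and convolution of the heat kernel, by reduction to dimension one *)

Section gaussian.
Context {R : realType}.

Definition gauss1 (t a : R) : R :=
  (4 * pi * t) `^ (- 2^-1) * expR (- (a ^+ 2 / (4 * t))).

Lemma gauss1_ge0 t a : 0 <= gauss1 t a.
Proof. by rewrite mulr_ge0 ?powR_ge0 ?expR_ge0. Qed.

(** The kernel at time t is the normal density of variance 2t, which supplies its measurability and
    its total mass. *)
Lemma gauss1E t a b : 0 < t -> gauss1 t (a - b) = normal_pdf a (Num.sqrt (2 * t)) b.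
Proof.
move=> t0; rewrite normal_pdfE ?gt_eqF ?sqrtr_gt0 ?mulr_gt0//.
rewrite /normal_peak /normal_fun sqr_sqrtr; last by rewrite mulr_ge0// ltW.
congr (_ * _).
  rewrite powRN powR12_sqrt; last by rewrite !mulr_ge0 ?pi_ge0// ltW.
  by congr (_^-1); congr Num.sqrt; ring.
congr expR; rewrite mulNr; congr (- (_ / _)); ring.
Qed.

Lemma measurable_gauss1 t a :
  0 < t -> measurable_fun [set: R] (fun b => gauss1 t (a - b)).
Proof.
move=> t0; rewrite (_ : (fun _ => _) = normal_pdf a (Num.sqrt (2 * t))).
  exact: measurable_normal_pdf.
by apply/funext => b; exact: gauss1E.
Qed.

Lemma integral_gauss1 t a : 0 < t ->
  (\int[@lebesgue_measure R]_b (gauss1 t (a - b))%:E = 1)%E.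
Proof.
move=> t0; rewrite -(integral_normal_pdf a (Num.sqrt (2 * t))).
by apply: eq_integral => b _; rewrite gauss1E.
Qed.

(* Completing the square in b: the second factor has total mass 1. *)
Lemma gauss1_mul (s t a b c : R) : 0 < s -> 0 < t ->
  gauss1 t (a - b) * gauss1 s (b - c) =
  gauss1 (t + s) (a - c) *
  gauss1 (t * s / (t + s)) ((s * a + t * c) / (t + s) - b).
Proof.
move=> s0 t0; have st0 : 0 < t + s by rewrite addr_gt0.
rewrite /gauss1 mulrACA [RHS]mulrACA -!expRD; congr (_ * expR _).
  have p0 := @pi_gt0 R.
  rewrite -!powRM ?mulr_ge0 ?invr_ge0 ?mulr_ge0 ?(ltW p0) ?(ltW s0) ?(ltW t0)
    ?(ltW st0)//.
  congr (_ `^ _); field; exact: lt0r_neq0.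
by field; rewrite !lt0r_neq0.
Qed.

Lemma integral_gauss1_mul s t a c : 0 < s -> 0 < t ->
  (\int[@lebesgue_measure R]_b (gauss1 t (a - b) * gauss1 s (b - c))%:E =
  (gauss1 (t + s) (a - c))%:E)%E.
Proof.
move=> s0 t0; have st0 : 0 < t + s by rewrite addr_gt0.
have r0 : 0 < t * s / (t + s) by rewrite !mulr_gt0 ?invr_gt0.
under eq_integral do rewrite gauss1_mul// EFinM.
rewrite ge0_integralZl ?integral_gauss1 ?mule1//.
- by apply/measurable_EFinP; exact: measurable_gauss1.
- by move=> b _; rewrite lee_fin gauss1_ge0.
- by rewrite lee_fin gauss1_ge0.
Qed.

Lemma rV_consB n a b (v w : 'rV[R]_n) :
  rV_cons (a, v) - rV_cons (b, w) = rV_cons (a - b, v - w).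
Proof.
apply/rowP => i; rewrite [LHS]mxE [X in _ + X]mxE.
have [j ->|->] := unliftP ord0 i.
  by rewrite !rV_consS !mxE.
by rewrite !rV_cons0.
Qed.

Lemma rV_consZ n c a (v : 'rV[R]_n) : c *: rV_cons (a, v) = rV_cons (c * a, c *: v).
Proof.
apply/rowP => i; rewrite [LHS]mxE.
have [j ->|->] := unliftP ord0 i.
  by rewrite !rV_consS !mxE.
by rewrite !rV_cons0.
Qed.

Lemma sqr_enorm n (x : 'rV[R]_n) : enorm x ^+ 2 = \sum_(i < n) x ord0 i ^+ 2.
Proof. by rewrite /enorm sqr_sqrtr// sumr_ge0// => i _; rewrite sqr_ge0. Qed.

Lemma heat_kernel_cons n t a (v : 'rV[R]_n) : 0 < t ->
  heat_kernel t (rV_cons (a, v)) = gauss1 t a * heat_kernel t v.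
Proof.
move=> t0; rewrite /heat_kernel /gauss1 mulrACA -expRD; congr (_ * expR _).
  rewrite -powRD; last first.
    by apply/implyP => _; rewrite gt_eqF// !mulr_gt0 ?pi_gt0.
  by congr (_ `^ _); rewrite -natr1; field.
rewrite !sqr_enorm big_ord_recl rV_cons0.
under eq_bigr do rewrite rV_consS.
by rewrite mulrDl opprD.
Qed.

Lemma heat_kernel0 t (x : 'rV[R]_0) : heat_kernel t x = 1.
Proof.
rewrite /heat_kernel sqr_enorm big_ord0 !mul0r !oppr0 expR0 mulr1.
by rewrite powRr0.
Qed.

Lemma integral_rV0 (f : 'rV[R]_0 -> \bar R) :
  (\int[lebesgue_rV 0]_x f x = f 0%R)%E.
Proof.
rewrite integral_dirac// ?diracT ?mul1e//.
apply: (eq_measurable_fun (cst (f 0))) => //.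
by move=> x _; rewrite /=; congr f; apply/rowP => -[].
Qed.

Lemma integral_heat_kernel n t (x : 'rV[R]_n) : 0 < t ->
  (\int[lebesgue_rV n]_y (heat_kernel t (x - y))%:E = 1)%E.
Proof.
move=> t0; elim: n x => [|n IH] x; first by rewrite integral_rV0 heat_kernel0.
rewrite -(rV_unconsK x); case: (rV_uncons x) => a v.
rewrite integral_rV_cons; last 2 first.
- apply/measurable_EFinP; apply: measurable_heat_kernel => //.
  exact: measurable_rVB.
- by move=> y; rewrite lee_fin heat_kernel_ge0.
rewrite -(integral_gauss1 a t0); apply: eq_integral => b _.
under eq_integral do rewrite rV_consB heat_kernel_cons// EFinM.
rewrite ge0_integralZl ?IH ?mule1//.
- apply/measurable_EFinP; apply: measurable_heat_kernel => //.
  exact: measurable_rVB.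
- by move=> y _; rewrite lee_fin heat_kernel_ge0.
- by rewrite lee_fin gauss1_ge0.
Qed.

(** The Chapman-Kolmogorov identity: the kernel factors along the first coordinate, where completing
    the square settles the matter, and the other coordinates follow by induction. *)
Lemma heat_kernel_semigroup n (s t : R) (x z : 'rV[R]_n) : 0 < s -> 0 < t ->
  (\int[lebesgue_rV n]_y (heat_kernel t (x - y) * heat_kernel s (y - z))%:E =
   (heat_kernel (t + s) (x - z))%:E)%E.
Proof.
move=> s0 t0; have st0 : 0 < t + s by rewrite addr_gt0.
elim: n x z => [|n IH] x z; first by rewrite integral_rV0 !heat_kernel0 mulr1.
have mh k r q (u w : 'rV[R]_k) : measurable_fun [set: 'rV[R]_k]
    (fun y => (heat_kernel r (u - y) * heat_kernel q (y - w))%:E).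
  apply/measurable_EFinP; apply: measurable_funM.
    by apply: measurable_heat_kernel => //; exact: measurable_rVB.
  by apply: measurable_heat_kernel => //; exact: measurable_rVB.
have mg c : measurable_fun [set: R] (fun b => gauss1 s (b - c)).
  rewrite (_ : (fun _ => _) = fun b => gauss1 s (c - b)).
    exact: measurable_gauss1.
  by apply/funext => b; rewrite /gauss1 -sqrrN opprB.
rewrite -(rV_unconsK x) -(rV_unconsK z).
case: (rV_uncons x) (rV_uncons z) => a v [c w].
rewrite integral_rV_cons//; last first.
  by move=> y; rewrite lee_fin mulr_ge0 ?heat_kernel_ge0.
rewrite rV_consB heat_kernel_cons// [RHS]EFinM -integral_gauss1_mul//.
rewrite -ge0_integralZr//; last 3 first.
- apply/measurable_EFinP; apply: measurable_funM; first exact: measurable_gauss1.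
  exact: mg.
- by move=> b _; rewrite lee_fin mulr_ge0 ?gauss1_ge0.
- by rewrite lee_fin heat_kernel_ge0.
apply: eq_integral => b _.
under eq_integral do rewrite !rV_consB !heat_kernel_cons// mulrACA EFinM.
rewrite ge0_integralZl// ?IH//.
- exact: mh.
- by move=> y _; rewrite lee_fin mulr_ge0 ?heat_kernel_ge0.
- by rewrite lee_fin mulr_ge0 ?gauss1_ge0.
Qed.

End gaussian.

(** * Lebesgue measure under dilations *)

Section scaling.
Context {R : realType}.
Variables (c : R) (c0 : 0 < c).

Let dil (x : measurableTypeR R) : measurableTypeR R := c * x.

Let mdil : measurable_fun [set: measurableTypeR R] dil.
Proof. exact: measurable_funM. Qed.

(** The pushforward of Lebesgue measure under the dilation, multiplied by c, gives each half-open
    interval its length; by uniqueness it is Lebesgue measure. *)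
Lemma integral_lebesgue_scale (f : R -> \bar R) :
  measurable_fun [set: R] f -> (forall x, 0 <= f x)%E ->
  (\int[@lebesgue_measure R]_x f (c * x)%R =
   c^-1%:E * \int[@lebesgue_measure R]_x f x)%E.
Proof.
move=> mf f0; have c_ge0 : 0 <= c by exact: ltW.
have pushE := ge0_integral_pushforward mdil (@lebesgue_measure R) measurableT mf
  (fun y _ => f0 y).
rewrite preimage_setT in pushE; rewrite -[LHS]pushE => {pushE}.
set nu := (X in integral X _ _).
rewrite [X in (_ * X)%E](eq_measure_integral (mscale (NngNum c_ge0) nu)).
  by rewrite ge0_integral_mscale//= muleA -EFinM mulVf ?gt_eqF// mul1e.
move=> A mA _; apply: lebesgue_measure_unique => //= _ [[a b]] _ <-.
rewrite /mscale /= /nu /pushforward.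
rewrite (_ : _ @^-1` _ = `]a / c, b / c]%classic); last first.
  apply/seteqP; split => x /=; rewrite !in_itv /= /dil;
    by rewrite ltr_pdivrMr// ler_pdivlMr// (mulrC x).
rewrite !lebesgue_measure_itv /= !lte_fin ltr_pM2r ?invr_gt0//.
case: ifP => _; last by rewrite mule0.
by rewrite -EFinM -mulrBl mulrCA divff ?mulr1// gt_eqF.
Qed.

Lemma integral_rV_scale n (f : 'rV[R]_n -> \bar R) :
  measurable_fun [set: 'rV[R]_n] f -> (forall x, 0 <= f x)%E ->
  (\int[lebesgue_rV n]_x f (c *: x)%R =
   (c^-1 ^+ n)%:E * \int[lebesgue_rV n]_x f x)%E.
Proof.
elim: n f => [|n IH] f mf f0.
  by rewrite !integral_rV0 expr0 mul1e scaler0.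
have mcf : measurable_fun [set: 'rV[R]_n.+1] (fun x => f (c *: x)).
  by apply: measurableT_comp => //; exact: measurable_rVZ.
rewrite !integral_rV_cons//.
have mcons : measurable_fun [set: R * 'rV[R]_n] (fun p => f (rV_cons p)).
  by apply: measurableT_comp => //; exact: measurable_rV_cons.
have mrow a : measurable_fun [set: 'rV[R]_n] (fun v => f (rV_cons (a, v))).
  by apply: (measurableT_comp mcons); exact: measurable_pair1.
have mF : measurable_fun [set: R] (fun a => \int[lebesgue_rV n]_v f (rV_cons (a, v)))%E.
  apply: (@measurable_fun_fubini_tonelli_F _ _ _ _ _ (lebesgue_rV n)
    (fun p => f (rV_cons p))) => // x; exact: f0.
have mFc : measurable_fun [set: R]
    (fun a => \int[lebesgue_rV n]_v f (rV_cons ((c * a)%R, v)))%E.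
  have mc : measurable_fun [set: R] (fun x : R => c * x) by exact: measurable_funM.
  exact: (measurableT_comp mF mc).
(* Of the n + 1 factors 1/c, one rescales the first coordinate and the others come from the
   induction hypothesis. *)
rewrite exprSr EFinM -muleA -integral_lebesgue_scale//; last first.
  by move=> x; exact: integral_ge0.
rewrite -ge0_integralZl//; last 2 first.
- by move=> x _; apply: integral_ge0 => v _; exact: f0.
- by rewrite lee_fin exprn_ge0// invr_ge0 ltW.
apply: eq_integral => a _.
rewrite -IH//; apply: eq_integral => v _.
by rewrite rV_consZ.
Qed.

End scaling.

(** * Blow-up time for the integral form of y' = y^(1+alpha) *)

Section blowup.
Context {R : realType}.

(** Combines exp(alpha ln q) >= 1 + alpha ln q with ln q >= 1 - 1/q. *)
Lemma powR_subr1_ge (q alpha : R) : 0 < alpha -> 1 < q ->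
  alpha * (q - 1) / q <= q `^ alpha - 1.
Proof.
move=> a0 q1; have q0 : 0 < q by rewrite (lt_trans _ q1).
rewrite lerBrDl; apply: le_trans (_ : 1 + alpha * ln q <= _); last first.
  by rewrite /powR gt_eqF// expR_ge1Dx.
rewrite lerD2l -mulrA ler_wpM2l ?(ltW a0)//.
have := @le_ln1Dx R (q^-1 - 1).
rewrite [1 + _]addrC subrK lnV ?posrE// => h.
have /h : -1 < q^-1 - 1 by rewrite ltrBrDl subrr invr_gt0.
by move=> {}h; rewrite mulrBl divff ?gt_eqF// mul1r; lra.
Qed.

(* For q > 1, H gains a factor q each time it runs for
   (q - 1) (q^i H(0))^(-alpha); these durations form a geometric series whose
   sum is at most H(0)^(-alpha) q^(1+alpha) / alpha, so H would be unbounded on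
   [0, t[ if t exceeded that sum. Then let q tend to 1. *)
Lemma powR_blowup_time (alpha t C : R) (H : R -> R) :
  0 < alpha -> 0 < t -> 0 < H 0 ->
  (forall s1 s2, 0 <= s1 -> s1 <= s2 -> s2 < t ->
    H s1 + (s2 - s1) * H s1 `^ (1 + alpha) <= H s2) ->
  (forall s, 0 <= s -> s < t -> H s <= C) ->
  alpha * t * H 0 `^ alpha <= 1.
Proof.
move=> a0 t0 H0 Hinc HC.
set h := H 0.
have ha0 : 0 < h `^ alpha by exact: powR_gt0.
suff key (q : R) : 1 < q -> t <= (h `^ alpha)^-1 * (q `^ (1 + alpha) / alpha).
  (* Taking the (1+alpha)-th root leaves q alone on the right, so that q = 1 + e with e arbitrarily
     small finishes. *)
  have {}key (q : R) : 1 < q -> (alpha * t * h `^ alpha) `^ (1 + alpha)^-1 <= q.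
    move=> q1; have q0 : 0 < q by rewrite (lt_trans _ q1).
    rewrite -[leRHS](@powRr1 _ q) ?(ltW q0)//.
    rewrite -[X in _ <= q `^ X](@divff _ (1 + alpha)) ?gt_eqF ?addr_gt0//.
    rewrite powRrM ge0_ler_powR//.
    - by rewrite invr_ge0 ltW// addr_gt0.
    - by rewrite nnegrE !mulr_ge0 ?powR_ge0// ltW.
    - by rewrite nnegrE powR_ge0.
    have := key _ q1; rewrite mulrC mulrAC ler_pdivlMr// ler_pdivlMr//.
    by rewrite (mulrC alpha t) mulrAC.
  have E1 : 1 `^ (1 + alpha) = 1 :> R by rewrite powR1.
  rewrite -(powRr1 (_ : 0 <= alpha * t * h `^ alpha)); last first.
    by rewrite !mulr_ge0 ?powR_ge0// ltW.
  rewrite -[X in _ `^ X](@mulVf _ (1 + alpha)) ?gt_eqF ?addr_gt0//.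
  rewrite powRrM -[leRHS]E1 ge0_ler_powR//.
  - by rewrite ltW// addr_gt0.
  - by rewrite nnegrE powR_ge0.
  - by rewrite nnegrE.
  by apply/ler_addgt0Pl => e e0; apply: key; rewrite ltrDr.
move=> q1; have q0 : 0 < q by rewrite (lt_trans _ q1).
rewrite leNgt; apply/negP => lt_t.
pose K := (h `^ alpha)^-1 * (q `^ (1 + alpha) / alpha).
(* Partial sums, in closed form, of a geometric series with ratio q^(-alpha) and total [K]. *)
pose s i := K * (1 - (q `^ alpha)^-1 ^+ i).
have K0 : 0 < K by rewrite !mulr_gt0 ?invr_gt0 ?powR_gt0.
have qa1 : 1 < q `^ alpha.
  rewrite -subr_gt0 (lt_le_trans _ (powR_subr1_ge a0 q1))//.
  by rewrite !mulr_gt0 ?invr_gt0 ?subr_gt0.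
have sle i : s i <= K.
  by rewrite /s ger_pMr// gerBl exprn_ge0// invr_ge0 powR_ge0.
have s_ge0 i : 0 <= s i.
  rewrite /s mulr_ge0 ?(ltW K0)// subr_ge0 exprn_ile1 ?invr_ge0 ?powR_ge0//.
  by rewrite invf_le1 ?powR_gt0// ltW.
(* By [powR_subr1_ge] the gap is at least (q - 1) (q^i h)^(-alpha), the time in which [Hinc] raises
   q^i h to q^(i+1) h. *)
have sS i : (q - 1) * q ^+ i * h <= (s i.+1 - s i) * (q ^+ i * h) `^ (1 + alpha).
  have hi0 : 0 < q ^+ i * h by rewrite mulr_gt0 ?exprn_gt0.
  rewrite (_ : s i.+1 - s i = K * (1 - (q `^ alpha)^-1) * (q `^ alpha)^-1 ^+ i);
    last first.
    by rewrite /s exprSr; ring.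
  rewrite powRD; last by apply/implyP => _; rewrite gt_eqF.
  rewrite powRr1 ?(ltW hi0)// powRM ?exprn_ge0 ?(ltW q0) ?(ltW H0)//.
  rewrite (_ : (q ^+ i) `^ alpha = (q `^ alpha) ^+ i); last first.
    by rewrite -!powR_mulrn ?powR_ge0 ?(ltW q0)// -!powRrM mulrC.
  rewrite exprVn.
  have X0 : 0 < (q `^ alpha) ^+ i by rewrite exprn_gt0// powR_gt0.
  rewrite [leRHS](_ : _ = (q `^ (1 + alpha) / alpha * (1 - (q `^ alpha)^-1)) *
    (q ^+ i * h)); last first.
    by rewrite /K; field; rewrite !gt_eqF// powR_gt0.
  rewrite -mulrA ler_pM2r//.
  rewrite powRD; last by apply/implyP => _; rewrite gt_eqF.
  rewrite powRr1 ?(ltW q0)//.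
  rewrite [leRHS](_ : _ = q / alpha * (q `^ alpha - 1)); last first.
    by field; rewrite !gt_eqF// powR_gt0.
  have := powR_subr1_ge a0 q1.
  rewrite ler_pdivrMr// => /(ler_wpM2l (ltW (divr_gt0 ltr01 a0))).
  by rewrite mul1r mulrA mulVf ?gt_eqF// mul1r => /le_trans; apply; lra.
have Hs i : q ^+ i * h <= H (s i).
  elim: i => [|i IH]; first by rewrite expr0 mul1r /s expr0 subrr mulr0.
  have s01 : s i <= s i.+1.
    rewrite /s ler_pM2l// lerD2l lerN2 exprS ler_piMl ?exprn_ge0 ?invr_ge0 ?powR_ge0//.
    by rewrite invf_le1 ?powR_gt0// ltW.
  apply: le_trans (Hinc _ _ (s_ge0 i) s01 (le_lt_trans (sle _) lt_t)).
  rewrite exprS -mulrA.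
  have hi0 : 0 < q ^+ i * h by rewrite mulr_gt0 ?exprn_gt0.
  apply: (@le_trans _ _ (q ^+ i * h + (s i.+1 - s i) * (q ^+ i * h) `^ (1 + alpha))).
    by have := sS i; lra.
  apply: lerD => //; rewrite ler_wpM2l ?subr_ge0// ge0_ler_powR//.
  - by rewrite ltW// addr_gt0.
  - by rewrite nnegrE ltW.
  - by rewrite nnegrE (le_trans _ IH)// ltW.
have [i Ci] : exists i, C / h < q ^+ i.
  have : (q^-1 ^+ n) @[n --> \oo] --> (0 : R).
    by apply: cvg_expr; rewrite ger0_norm ?invr_ge0 ?(ltW q0)// invf_lt1.
  have X0 : 0 < (`|C / h| + 1)^-1 by rewrite invr_gt0 ltr_wpDl.
  move=> /cvgrPdist_lt /(_ _ X0) [i _ /(_ i (leqnn i))].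
  rewrite sub0r normrN ger0_norm; last by rewrite exprn_ge0// invr_ge0 ltW.
  rewrite exprVn ltf_pV2 ?posrE ?exprn_gt0 ?ltr_wpDl// => Xi.
  exists i; apply: le_lt_trans Xi.
  by rewrite (le_trans (ler_norm _))// lerDl.
have := HC _ (s_ge0 i) (le_lt_trans (sle i) lt_t).
rewrite leNgt (lt_le_trans _ (Hs i))// -ltr_pdivrMr//.
Qed.

End blowup.

(** * The heat semigroup on functions with values in [0,+oo]: linearity, semigroup law, Jensen's
    inequality *)

Section heat_theory.
Context {R : realType} {n : nat}.
Implicit Types (f g : 'rV[R]_n -> \bar R) (x : 'rV[R]_n) (s t : R).
Local Open Scope ereal_scope.

Lemma eq_heat t f g x : (forall y, f y = g y) -> heat t f x = heat t g x.
Proof. by move=> fg; apply: eq_integral => y _; rewrite fg. Qed.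

Lemma ae_eq_heat t f g x :
  measurable_fun [set: 'rV[R]_n] f -> measurable_fun [set: 'rV[R]_n] g ->
  (\forall y \ae lebesgue_rV n, f y = g y) -> heat t f x = heat t g x.
Proof.
move=> mf mg fg; apply: ae_eq_integral => //; try exact: measurable_heat_integrand.
by apply: filterS fg => y -> _.
Qed.

Lemma le_heat t f g x :
  measurable_fun [set: 'rV[R]_n] f -> measurable_fun [set: 'rV[R]_n] g ->
  (forall y, 0 <= f y) -> (forall y, f y <= g y) -> heat t f x <= heat t g x.
Proof.
move=> mf mg f0 fg; apply: ge0_le_integral => //; try exact: measurable_heat_integrand.
  by move=> y _; rewrite mule_ge0// lee_fin heat_kernel_ge0.
by move=> y _; rewrite lee_wpmul2l// lee_fin heat_kernel_ge0.
Qed.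

Lemma heatD t f g x :
  measurable_fun [set: 'rV[R]_n] f -> measurable_fun [set: 'rV[R]_n] g ->
  (forall y, 0 <= f y) -> (forall y, 0 <= g y) ->
  heat t (fun y => f y + g y) x = heat t f x + heat t g x.
Proof.
move=> mf mg f0 g0; rewrite /heat -ge0_integralD//; first last.
- exact: measurable_heat_integrand.
- by move=> y _; rewrite mule_ge0// lee_fin heat_kernel_ge0.
- exact: measurable_heat_integrand.
- by move=> y _; rewrite mule_ge0// lee_fin heat_kernel_ge0.
by apply: eq_integral => y _; rewrite ge0_muleDr.
Qed.

Lemma heatZ t f x (c : R) : measurable_fun [set: 'rV[R]_n] f ->
  (forall y, 0 <= f y) -> (0 <= c)%R ->
  heat t (fun y => c%:E * f y) x = c%:E * heat t f x.
Proof.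
move=> mf f0 c0; rewrite /heat -ge0_integralZl//; first last.
- by move=> y _; rewrite mule_ge0// lee_fin heat_kernel_ge0.
- exact: measurable_heat_integrand.
by apply: eq_integral => y _; rewrite muleCA.
Qed.

Lemma heat_cst t x (c : R) : (0 < t)%R -> (0 <= c)%R -> heat t (cst c%:E) x = c%:E.
Proof.
move=> t0 c0; rewrite /heat /= ge0_integralZr//.
- by rewrite integral_heat_kernel// mul1e.
- by apply/measurable_EFinP; apply: measurable_heat_kernel => //; exact: measurable_rVB.
- by move=> y _; rewrite lee_fin heat_kernel_ge0.
Qed.

(** Tonelli's theorem reduces the semigroup law to the Chapman-Kolmogorov identity for the kernels,
    infinite values included. *)
Lemma heat_heat s t f x : (0 < s)%R -> (0 < t)%R ->
  measurable_fun [set: 'rV[R]_n] f -> (forall y, 0 <= f y) ->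
  heat t (heat s f) x = heat (t + s) f x.
Proof.
move=> s0 t0 mf f0; rewrite /heat.
pose F (p : 'rV[R]_n * 'rV[R]_n) :=
  (heat_kernel t (x - p.1) * heat_kernel s (p.1 - p.2))%:E * f p.2.
have mF : measurable_fun [set: 'rV[R]_n * 'rV[R]_n] F.
  apply: emeasurable_funM; last exact: measurableT_comp.
  apply/measurable_EFinP; apply: measurable_funM; apply: measurable_heat_kernel => //;
    exact: measurable_rVB.
have F0 p : 0 <= F p.
  by rewrite mule_ge0// lee_fin mulr_ge0 ?heat_kernel_ge0.
transitivity (\int[lebesgue_rV n]_y \int[lebesgue_rV n]_z F (y, z)).
  apply: eq_integral => y _; rewrite -ge0_integralZl//.
  - by apply: eq_integral => z _; rewrite muleA.
  - exact: measurable_heat_integrand.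
  - by move=> z _; rewrite mule_ge0// lee_fin heat_kernel_ge0.
  - by rewrite lee_fin heat_kernel_ge0.
rewrite fubini_tonelli//; apply: eq_integral => z _.
rewrite /F /= ge0_integralZr//.
- by rewrite heat_kernel_semigroup.
- apply/measurable_EFinP; apply: measurable_funM; apply: measurable_heat_kernel => //;
    exact: measurable_rVB.
- by move=> y _; rewrite lee_fin mulr_ge0 ?heat_kernel_ge0.
Qed.

Lemma measurable_integral_param (D : set R) (K : R -> 'rV[R]_n -> \bar R) :
  measurable D -> (forall r y, 0 <= K r y) ->
  measurable_fun [set: R * 'rV[R]_n] (fun p : R * 'rV[R]_n => K p.1 p.2) ->
  measurable_fun [set: 'rV[R]_n] (fun y => \int[@lebesgue_measure R]_(r in D) K r y).
Proof.
move=> mD K0 mK.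
(* Extension by zero off [D] turns the integral into one over the whole line, where the Tonelli
   measurability result applies. *)
pose f : R * 'rV[R]_n -> \bar R := (fun q : R * 'rV[R]_n => K q.1 q.2) \_ (D `*` setT).
have mf : measurable_fun [set: R * 'rV[R]_n] f.
  apply/measurable_restrict => //; first exact: measurableX.
  by rewrite setTI; exact: measurable_funS mK.
have f0 p : 0 <= f p by rewrite /f /patch; case: ifP.
have := @measurable_fun_fubini_tonelli_G _ _ (measurableTypeR R) 'rV[R]_n R
  (@lebesgue_measure R) f mf f0.
congr measurable_fun; apply/funext => y; rewrite [RHS]integral_mkcond.
by apply: eq_integral => r _; rewrite /f /patch in_setX in_setT andbT.
Qed.

Lemma heat_integral t (D : set R) (K : R -> 'rV[R]_n -> \bar R) x :
  measurable D -> (forall r y, 0 <= K r y) ->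
  measurable_fun [set: R * 'rV[R]_n] (fun p : R * 'rV[R]_n => K p.1 p.2) ->
  heat t (fun y => \int[@lebesgue_measure R]_(r in D) K r y) x =
  \int[@lebesgue_measure R]_(r in D) heat t (K r) x.
Proof.
move=> mD K0 mK; rewrite [RHS]integral_mkcond /heat.
pose F (p : 'rV[R]_n * R) :=
  (heat_kernel t (x - p.1))%:E *
  ((fun q : R * 'rV[R]_n => K q.1 q.2) \_ (D `*` setT)) (p.2, p.1).
have mF : measurable_fun [set: 'rV[R]_n * R] F.
  apply: emeasurable_funM.
    apply/measurable_EFinP; apply: measurable_heat_kernel => //.
    exact: measurable_rVB.
  apply: (@measurableT_comp _ _ _ _ _ _ _ _ (fun p : 'rV[R]_n * R => (p.2, p.1))).
    apply/measurable_restrict => //; first exact: measurableX.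
    by rewrite setTI; exact: measurable_funS mK.
  by apply: measurable_fun_pair.
have F0 p : 0 <= F p.
  by rewrite mule_ge0 ?lee_fin ?heat_kernel_ge0// /patch; case: ifP.
have mKy y : measurable_fun [set: R] (K^~ y).
  apply: (measurableT_comp mK (_ : measurable_fun setT (fun r : R => (r, y)))).
  exact: measurable_fun_pair.
transitivity (\int[lebesgue_rV n]_y \int[@lebesgue_measure R]_r F (y, r)).
  apply: eq_integral => y _; rewrite integral_mkcond -ge0_integralZl//.
  - apply: eq_integral => r _; rewrite /F /patch /=; congr (_ * _).
    by rewrite in_setX in_setT andbT.
  - apply/measurable_restrict => //; rewrite setTI.
    exact: measurable_funS (mKy y).
  - by move=> r _; rewrite /patch; case: ifP.
  - by rewrite lee_fin heat_kernel_ge0.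
rewrite (@fubini_tonelli _ _ _ _ _ (lebesgue_rV n) (@lebesgue_measure R))//.
apply: eq_integral => r _; rewrite /F /patch /=.
under eq_integral do rewrite in_setX in_setT andbT.
case: ifP => _ //; under eq_integral do rewrite mule0.
by rewrite integral0.
Qed.

(** The tangent line at c to the convex function y^(1+a). It is Young's inequality for y and c^a
    with conjugate exponents 1 + a and (1 + a) / a. *)
Lemma young_powR (a c y : R) : (0 < a -> 0 <= c -> 0 <= y ->
  (1 + a) * c `^ a * y <= y `^ a * y + a * c `^ (1 + a))%R.
Proof.
move=> a0 c0 y0; have a1 : (0 < 1 + a)%R by rewrite addr_gt0.
have := @conjugate_powR R y (c `^ a)%R (1 + a)%R ((1 + a) / a)%R y0 (powR_ge0 _ _) a1.
rewrite divr_gt0// -powRrM mulrCA divff ?gt_eqF// mulr1 => /(_ isT).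
have -> : ((1 + a)^-1 + ((1 + a) / a)^-1 = 1)%R.
  by field; rewrite !gt_eqF.
move=> /(_ erefl) /(ler_wpM2l (ltW a1)).
rewrite [leRHS](_ : _ = y `^ (1 + a) + a * c `^ (1 + a))%R; last first.
  by field; rewrite !gt_eqF.
have -> : (y `^ (1 + a) = y `^ a * y)%R.
  rewrite powRD; last by apply/implyP; rewrite (gt_eqF a1).
  by rewrite powRr1// mulrC.
by apply: le_trans; rewrite -mulrA ler_pM2l// mulrC.
Qed.

Lemma measurable_heat_power d (T : measurableType d) (a : R) (F : T -> \bar R) :
  measurable_fun [set: T] F -> measurable_fun [set: T] (fun y => `|F y| `^ a * F y).
Proof.
move=> mF; apply: emeasurable_funM => //.
apply: (measurableT_comp (measurable_poweR a)).
exact: measurableT_comp.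
Qed.

(* Integrating the tangent line inequality [young_powR] against the kernel,
   which has mass 1. *)
Lemma heat_jensen t f x (a c : R) : (0 < a)%R -> (0 < t)%R ->
  measurable_fun [set: 'rV[R]_n] f -> (forall y, 0 <= f y) ->
  heat t f x = c%:E ->
  (c `^ (1 + a))%:E <= heat t (fun y => `|f y| `^ a * f y) x.
Proof.
move=> a0 t0 mf f0 fc.
have c0 : (0 <= c)%R by rewrite -lee_fin -fc; exact: heat_ge0.
have P0 y : 0 <= `|f y| `^ a * f y by rewrite mule_ge0 ?poweR_ge0.
have mP : measurable_fun [set: 'rV[R]_n] (fun y => `|f y| `^ a * f y).
  exact: measurable_heat_power.
have cE : (c `^ (1 + a) = c `^ a * c)%R.
  rewrite powRD; last by apply/implyP; rewrite gt_eqF ?addr_gt0.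
  by rewrite powRr1// mulrC.
have : heat t (fun y => ((1 + a) * c `^ a)%:E * f y) x <=
   heat t (fun y => `|f y| `^ a * f y + cst (a * c `^ (1 + a))%:E y) x.
  apply: le_heat.
  - exact: measurable_funeM.
  - exact: emeasurable_funD.
  - by move=> y; rewrite mule_ge0// lee_fin mulr_ge0 ?powR_ge0// addr_ge0// ltW.
  move=> y; have := f0 y; case: (f y) => [r| |]//.
    rewrite lee_fin => r0; rewrite /= ger0_norm// -!EFinM -EFinD lee_fin.
    exact: young_powR.
  by move=> _; rewrite /= gt_eqF// mulyy addye// leey.
rewrite heatZ//; last by rewrite mulr_ge0 ?powR_ge0// addr_ge0// ltW.
rewrite fc heatD ?heat_cst//; last 2 first.
- by rewrite mulr_ge0 ?powR_ge0// ltW.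
- by move=> y; rewrite lee_fin mulr_ge0 ?powR_ge0// ltW.
rewrite -EFinM -mulrA -cE -leeBlDr// -EFinB => /(le_trans _); apply.
by rewrite lee_fin; lra.
Qed.

End heat_theory.

(** The measures of the sections of a null set integrate to 0, so almost every section is null. *)
Lemma ae_product_measure d1 d2 (T1 : measurableType d1) (T2 : measurableType d2)
    (R : realType) (m1 : {sigma_finite_measure set T1 -> \bar R})
    (m2 : {sigma_finite_measure set T2 -> \bar R}) (Q : T1 * T2 -> Prop) :
  (\forall p \ae (m1 \x m2)%E, Q p) ->
  \forall x \ae m1, \forall y \ae m2, Q (x, y).
Proof.
move=> [A [mA A0 QA]].
have mxA : measurable_fun [set: T1] (fun x => m2 (xsection A x)).
  exact: measurable_fun_xsection.
have : (\int[m1]_x `|m2 (xsection A x)| = 0)%E.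
  by rewrite -[RHS]A0; apply: eq_integral => x _; rewrite gee0_abs.
move/(ae_eq_integral_abs m1 measurableT mxA); apply: filterS => x /(_ I) /= xA0.
exists (xsection A x); split => //; first exact: measurable_xsection.
by move=> y Qy; apply/set_mem; rewrite mem_xsection inE; exact: QA.
Qed.

(** * The a priori bound satisfied by every solution *)

Section a_priori_bound.
Context {R : realType} {N : nat}.
Local Notation mu := (@lebesgue_rV R N).
Local Notation leb := (@lebesgue_measure R).
Variables (alpha T : R) (u0 : 'rV[R]_N -> R) (u : R -> 'rV[R]_N -> \bar R).
Hypotheses (alpha_gt0 : 0 < alpha) (mu0 : measurable_fun [set: 'rV[R]_N] u0)
  (u0_ge0 : \forall x \ae mu, 0 <= u0 x) (solu : is_solution alpha u0 T u).
Local Open Scope ereal_scope.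

(** The data are nonnegative only almost everywhere; the positive part has the same heat flow and
    meets the pointwise sign conditions of the lemmas on [heat]. *)
Let v0 (y : 'rV[R]_N) : \bar R := (Num.max (u0 y) 0%R)%:E.

Let mv0 : measurable_fun [set: 'rV[R]_N] v0.
Proof. by apply/measurable_EFinP; exact: measurable_maxr. Qed.

Let v0_ge0 y : 0 <= v0 y.
Proof. by rewrite lee_fin le_max lexx orbT. Qed.

Let heat_v0 t x : heat t (EFin \o u0) x = heat t v0 x.
Proof.
apply: ae_eq_heat => //; first exact/measurable_EFinP.
by apply: filterS u0_ge0 => y u0y; rewrite /v0 max_l.
Qed.

(** Measurability of u is given only on the strip 0 < s < T; the extension by zero is measurable on
    the whole product. *)
Let F (s : R) (y : 'rV[R]_N) : \bar R := if (0 < s < T)%R then u s y else 0.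

Let F_ge0 s y : 0 <= F s y.
Proof. by case: solu => _ u_ge0 _ _; rewrite /F; case: ifPn => // /u_ge0. Qed.

Let mF : measurable_fun [set: R * 'rV[R]_N] (fun p : R * 'rV[R]_N => F p.1 p.2).
Proof.
case: solu => mu_ _ _ _.
rewrite (_ : (fun _ => _) = (fun p : R * 'rV[R]_N => u p.1 p.2) \_ (`]0%R, T[ `*` setT)).
  apply/measurable_restrict => //; first exact: measurableX.
  by rewrite setTI.
by apply/funext => p; rewrite /F /patch in_setX in_setT andbT mem_setE in_itv.
Qed.

Let P (s : R) (y : 'rV[R]_N) : \bar R := `|F s y| `^ alpha * F s y.

Let P_ge0 s y : 0 <= P s y.
Proof. by rewrite mule_ge0 ?poweR_ge0. Qed.

Let mP : measurable_fun [set: R * 'rV[R]_N] (fun p : R * 'rV[R]_N => P p.1 p.2).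
Proof. exact: measurable_heat_power. Qed.

Let mFs s : measurable_fun [set: 'rV[R]_N] (F s).
Proof. exact: (measurableT_comp mF (measurable_pair1 s)). Qed.

Let mPs s : measurable_fun [set: 'rV[R]_N] (P s).
Proof. exact: (measurableT_comp mP (measurable_pair1 s)). Qed.

Let mheatP s : measurable_fun [set: R * 'rV[R]_N]
  (fun p : R * 'rV[R]_N => heat (s - p.1) (P p.1) p.2).
Proof.
apply: (@measurable_heat _ _ (R * 'rV[R]_N)%type N _ _ (fun p => P p.1)) => //.
- exact: measurable_funB.
- apply: (measurableT_comp mP (_ : measurable_fun setT
    (fun q : (R * 'rV[R]_N) * 'rV[R]_N => (q.1.1, q.2)))).
  apply: measurable_fun_pair => //; exact: measurableT_comp.
Qed.

Let E (s : R) (y : 'rV[R]_N) : \bar R :=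
  heat s v0 y + \int[leb]_(r in `]0%R, s[) heat (s - r) (P r) y.

Let mint s : measurable_fun [set: 'rV[R]_N]
  (fun y => \int[leb]_(r in `]0%R, s[) heat (s - r) (P r) y).
Proof. by apply: measurable_integral_param => // r y; exact: heat_ge0. Qed.

Let mE s : measurable_fun [set: 'rV[R]_N] (E s).
Proof.
apply: emeasurable_funD.
  exact: measurable_heatr.
exact: mint.
Qed.

(** The flow over time t - s carries the initial term and each source from time s to time t; only
    the sources at times before s contribute. *)
Let heat_E s t x : (0 < s < t)%R ->
  heat (t - s) (E s) x =
  heat t v0 x + \int[leb]_(r in `]0%R, s[) heat (t - r) (P r) x.
Proof.
move=> /andP[s0 st]; have ts0 : (0 < t - s)%R by rewrite subr_gt0.
rewrite /E (heatD _ _ (measurable_heatr s mv0 v0_ge0) (mint s)); last 2 first.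
- by move=> y; exact: heat_ge0.
- by move=> y; apply: integral_ge0 => r _; exact: heat_ge0.
rewrite (heat_heat _ s0 ts0 mv0 v0_ge0) subrK; congr (_ + _).
rewrite heat_integral;
  [|exact: measurable_itv|by move=> r y; exact: heat_ge0|exact: mheatP].
apply: eq_integral => r; rewrite inE/= in_itv/= => /andP[r0 rs].
have sr0 : (0 < s - r)%R by rewrite subr_gt0.
by rewrite (heat_heat _ sr0 ts0 (mPs r) (P_ge0 r)) addrA subrK.
Qed.

(** The integral equation restricted to almost every time slice, the form in which [heat] can be
    applied to it. *)
Let FE : \forall s \ae leb, (0 < s < T)%R -> \forall y \ae mu, F s y = E s y.
Proof.
case: solu => _ _ _ /ae_product_measure; apply: filterS => s + sT.
apply: filterS => y /= /(_ sT); rewrite /F sT => ->.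
rewrite heat_v0; congr (_ + _); apply: eq_integral => r.
rewrite inE/= in_itv/= => /andP[r0 rs]; apply: eq_heat => z.
by rewrite /P /F r0 (lt_trans rs)//; case/andP: sT.
Qed.

(* H s is heat (t - s) (u s) x for almost every s, by the semigroup property;
   it is finite because H t = u t x. *)
Lemma solution_bound : \forall p \ae (leb \x mu), (0 < p.1 < T)%R ->
  (alpha * p.1)%:E * heat p.1 (EFin \o u0) p.2 `^ alpha <= 1.
Proof.
have FL : Filter (almost_everywhere leb) by exact: ae_filter_ringOfSetsType.
have FF : Filter (almost_everywhere (leb \x mu)) by exact: ae_filter_ringOfSetsType.
case: solu => _ _ + +; apply: filterS2 => -[t x] /= + + tT.
move=> /(_ tT) ufin /(_ tT) uE.
have [t0 tltT] := andP tT.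
pose k s := heat (t - s) (P s) x.
have k_ge0 s : 0 <= k s by exact: heat_ge0.
have mk : measurable_fun [set: R] k.
  apply: (measurableT_comp (mheatP t) (_ : measurable_fun setT (fun r : R => (r, x)))).
  exact: measurable_fun_pair.
have mkD (D : set R) : measurable_fun D k by exact: measurable_funS mk.
pose H s := heat t v0 x + \int[leb]_(r in `]0%R, s[) k r.
have HtE : u t x = H t.
  rewrite uE heat_v0; congr (_ + _); apply: eq_integral => r.
  rewrite inE/= in_itv/= => /andP[r0 rt]; apply: eq_heat => z.
  by rewrite /P /F r0 (lt_trans rt).
have H_ge0 s : 0 <= H s.
  by rewrite adde_ge0 ?heat_ge0// integral_ge0.
have H_add s1 s2 : (0 <= s1)%R -> (s1 <= s2)%R ->
    H s1 + \int[leb]_(r in `]s1, s2[) k r <= H s2.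
  move=> s10 s12; rewrite /H -addeA leeD2l// -ge0_integral_setU//=; last 2 first.
  - exact: mkD.
  - rewrite disj_set2E; apply/eqP/seteqP; split=> // r [] /=.
    rewrite !in_itv/= => /andP[_ rs1] /andP[s1r _].
    by move: (lt_trans s1r rs1); rewrite ltxx.
  apply: ge0_subset_integral => //.
  - exact: measurableU.
  - exact: mkD.
  move=> r [] /=; rewrite !in_itv/= => /andP[].
    by move=> -> rs1; rewrite (lt_le_trans rs1).
  by move=> s1r ->; rewrite (le_lt_trans s10).
have H_le s1 s2 : (0 <= s1)%R -> (s1 <= s2)%R -> H s1 <= H s2.
  move=> s10 s12; apply: le_trans (H_add _ _ s10 s12).
  by rewrite leeDl// integral_ge0.
have H_fin s : (0 <= s)%R -> (s <= t)%R -> H s \is a fin_num.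
  move=> s0 st; rewrite ge0_fin_numE// (le_lt_trans (H_le _ _ s0 st))//.
  by rewrite -HtE ltey_eq ufin.
have heatF : \forall s \ae leb, (0 < s < t)%R -> heat (t - s) (F s) x = H s.
  apply: filterS FE => s + /andP[s0 st].
  have sT : (0 < s < T)%R by rewrite s0 (lt_trans st tltT).
  move=> /(_ sT) FsE.
  by rewrite (ae_eq_heat _ _ (mFs s) (mE s) FsE) heat_E ?s0.
have kH : \forall s \ae leb, (0 < s < t)%R -> (fine (H s) `^ (1 + alpha))%:E <= k s.
  apply: filterS heatF => s + st => /(_ st) Fs.
  have [s0 lst] := andP st.
  apply: heat_jensen => //; first by rewrite subr_gt0.
  by rewrite Fs fineK// H_fin// ltW.
(* Where the flow of the data vanishes the bound is trivial; elsewhere H(0) > 0, as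
   [powR_blowup_time] demands. *)
have [->|h0] := eqVneq (heat t (EFin \o u0) x) 0.
  by rewrite poweR0r ?gt_eqF// mule0.
have H0E : H 0%R = heat t v0 x.
  by rewrite /H set_itv_ge ?bnd_simp ?ltxx// integral_set0 adde0.
rewrite heat_v0 -H0E -[H 0%R]fineK ?H_fin// ?(ltW t0)// poweR_EFin -EFinM lee_fin.
apply: (@powR_blowup_time _ alpha t (fine (H t)) (fine \o H)) => //=.
- by rewrite fine_gt0// ltey_eq H_fin// ?(ltW t0)// lt0e H_ge0 H0E -heat_v0 h0.
- move=> s1 s2 s10 s12 s2t.
  have s1t := le_lt_trans s12 s2t.
  rewrite -lee_fin EFinD EFinM fineK ?H_fin ?(ltW s1t)// fineK; last first.
    by rewrite H_fin ?(ltW s2t)// (le_trans s10).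
  apply: le_trans (H_add _ _ s10 s12); rewrite leeD2l//.
  (* On this interval k(r) >= H(r)^(1+alpha) >= H(s1)^(1+alpha), since H is nondecreasing. *)
  apply: (@le_trans _ _ (\int[leb]_(r in `]s1, s2[) (fine (H s1) `^ (1 + alpha))%:E)).
    rewrite integral_cst//= lebesgue_measure_itv/= lte_fin muleC.
    case: ltP => [|s21]; first by [].
    by rewrite (@le_anti _ _ s1 s2) ?s12 ?s21// subrr !mule0.
  apply: ae_ge0_le_integral => //=.
  - by move=> r _; rewrite lee_fin powR_ge0.
  - exact: mkD.
  apply: filterS kH => r kr; rewrite in_itv/= => /andP[s1r rs2].
  have r0 := le_lt_trans s10 s1r.
  have rt := lt_trans rs2 s2t.
  apply: le_trans (kr _); last by rewrite r0.
  rewrite lee_fin ge0_ler_powR//.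
  - by rewrite ltW// addr_gt0.
  - by rewrite nnegrE fine_ge0.
  - by rewrite nnegrE fine_ge0.
  by rewrite fine_le ?H_fin ?H_le// ltW.
- move=> s s0 st.
  by rewrite fine_le ?H_fin ?H_le// ?(ltW st)// ltW.
Qed.

End a_priori_bound.

(** * Comparison, positivity, parabolic scaling and truncation for the heat flow *)

Section heat_comparison.
Context {R : realType} {N : nat}.
Local Notation mu := (@lebesgue_rV R N).
Implicit Types (f g : 'rV[R]_N -> \bar R) (x y : 'rV[R]_N) (t c : R).
Local Open Scope ereal_scope.

Lemma ae_le_heat t f g x :
  measurable_fun [set: 'rV[R]_N] f -> measurable_fun [set: 'rV[R]_N] g ->
  (forall y, 0 <= f y) -> (forall y, 0 <= g y) ->
  (\forall y \ae mu, f y <= g y) -> heat t f x <= heat t g x.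
Proof.
move=> mf mg f0 g0 fg; apply: ae_ge0_le_integral => //.
- by move=> y _; rewrite mule_ge0// lee_fin heat_kernel_ge0.
- exact: measurable_heat_integrand.
- by move=> y _; rewrite mule_ge0// lee_fin heat_kernel_ge0.
- exact: measurable_heat_integrand.
by apply: filterS fg => y fgy _; rewrite lee_wpmul2l// lee_fin heat_kernel_ge0.
Qed.

(** The kernel is strictly positive at positive times, so a single zero of the flow forces f to
    vanish. *)
Lemma heat_eq0 t f x : (0 < t)%R ->
  measurable_fun [set: 'rV[R]_N] f -> (forall y, 0 <= f y) ->
  heat t f x = 0 -> \forall y \ae mu, f y = 0.
Proof.
move=> t0 mf f0 h0.
have : \int[mu]_y `|(heat_kernel t (x - y))%:E * f y| = 0.
  rewrite -[RHS]h0; apply: eq_integral => y _.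
  by rewrite gee0_abs// mule_ge0// lee_fin heat_kernel_ge0.
move/(ae_eq_integral_abs mu measurableT (measurable_heat_integrand t x mf)).
apply: filterS => y /(_ I) /= /eqP; rewrite mule_eq0 => /orP[|/eqP//].
by rewrite eqe gt_eqF// heat_kernel_gt0.
Qed.

Lemma enormZ c x : (0 <= c)%R -> enorm (c *: x) = (c * enorm x)%R.
Proof.
move=> c0; rewrite /enorm.
under eq_bigr do rewrite mxE exprMn.
by rewrite -mulr_sumr sqrtrM ?sqr_ge0// sqrtr_sqr ger0_norm.
Qed.

Lemma enorm_ge0 x : (0 <= enorm x)%R.
Proof. exact: sqrtr_ge0. Qed.

Lemma enorm_eq0 x : enorm x = 0%R -> x = 0%R.
Proof.
move=> /eqP x0.
have {x0} : (enorm x ^+ 2 == 0)%R by rewrite sqrf_eq0.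
rewrite sqr_enorm psumr_eq0; last by move=> i _; exact: sqr_ge0.
move=> /allP x0; apply/rowP => i; rewrite mxE; apply/eqP.
by have := x0 i (mem_index_enum _); rewrite sqrf_eq0.
Qed.

Lemma heat_kernelZ c x : (0 < c)%R ->
  heat_kernel (c ^+ 2) (c *: x) = (c^-1 ^+ N * heat_kernel 1 x)%R.
Proof.
move=> c0; rewrite /heat_kernel enormZ ?(ltW c0)// !mulr1 [RHS]mulrA.
congr (_ * _)%R; last first.
  by congr expR; rewrite exprMn; field; rewrite gt_eqF.

rewrite powRM ?mulr_ge0 ?pi_ge0 ?exprn_ge0 ?(ltW c0)// mulrC; congr (_ * _)%R.
rewrite -[(c ^+ 2)%R]powR_mulrn ?(ltW c0)// -powRrM mulrN mulrCA divff// mulr1.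
by rewrite powR_invn ?(ltW c0)// exprVn.
Qed.

(** The change of variables y -> c y and [heat_kernelZ] produce the same factor c^(-N), which
    cancels. *)
Lemma heat_scale c f x : (0 < c)%R ->
  measurable_fun [set: 'rV[R]_N] f -> (forall y, 0 <= f y) ->
  heat (c ^+ 2) f (c *: x) = heat 1 (fun y => f (c *: y)) x.
Proof.
move=> c0 mf f0.
have cN0 : (0 < c^-1 ^+ N)%R by rewrite exprn_gt0// invr_gt0.
have mG := measurable_heat_integrand (c ^+ 2) (c *: x) mf.
have mfc : measurable_fun [set: 'rV[R]_N] (fun y => f (c *: y)).
  by apply: measurableT_comp => //; exact: measurable_rVZ.
have G0 y : 0 <= (heat_kernel (c ^+ 2) (c *: x - y))%:E * f y.
  by rewrite mule_ge0// lee_fin heat_kernel_ge0.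
have E0 := integral_rV_scale c0 mG G0.
have E1 : \int[mu]_y ((heat_kernel (c ^+ 2) (c *: x - c *: y))%:E * f (c *: y)) =
    (c^-1 ^+ N)%:E * heat 1 (fun y => f (c *: y)) x.
  rewrite /heat -ge0_integralZl.
  - by apply: eq_integral => y _; rewrite -scalerBr (heat_kernelZ _ c0) EFinM muleA.
  - exact: measurableT.
  - exact: measurable_heat_integrand.
  - by move=> y _; rewrite mule_ge0// lee_fin heat_kernel_ge0.
  - by rewrite lee_fin ltW.
have cancel_cN (a b : \bar R) : (c^-1 ^+ N)%:E * a = (c^-1 ^+ N)%:E * b -> a = b.
  move/(congr1 (fun z => (c ^+ N)%:E * z)).
  by rewrite !muleA -EFinM -exprMn (divff (lt0r_neq0 c0)) expr1n !mul1e.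
exact: (cancel_cN _ _ (etrans (esym E0) E1)).
Qed.

(** Dilations preserve null sets, as the scaling formula shows on indicators; this carries
    almost-everywhere hypotheses through the parabolic rescaling. *)
Lemma ae_scale c (Q : 'rV[R]_N -> Prop) : (0 < c)%R ->
  (\forall x \ae mu, Q x) -> \forall x \ae mu, Q (c *: x).
Proof.
move=> c0 [A [mA A0 QA]].
have mcA : measurable ((fun x : 'rV[R]_N => c *: x)%R @^-1` A).
  by rewrite -[X in measurable X]setTI; exact: (measurable_rVZ c).
exists ((fun x => c *: x)%R @^-1` A); split => //; last first.
  by move=> x Qx; exact: QA.
have mIA : measurable_fun [set: 'rV[R]_N] (fun x => (\1_A x)%:E : \bar R).
  by apply/measurable_EFinP; exact: measurable_indic.
have I0 x : 0 <= (\1_A x)%:E :> \bar R by rewrite lee_fin.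
have := integral_rV_scale c0 mIA I0.
have -> : \int[mu]_x (\1_A x)%:E = 0.
  by rewrite (integral_indic mu measurableT mA) setIT; exact: A0.
rewrite mule0 => <-.
have := integral_indic mu measurableT mcA; rewrite setIT => <-.
exact: eq_integral.
Qed.

Lemma lebesgue_rVT_gt0 : 0 < mu setT.
Proof.
have := @lebesgue_rV_box R N (fun=> setT) (fun=> measurableT).
rewrite (_ : [set x | _] = setT); last by apply/seteqP; split.
move=> ->; elim/big_ind: _ => // [a b a0 b0|i _]; first exact: mule_gt0.
by rewrite -set_itvNyy lebesgue_measure_itv/= addye.
Qed.

(** The origin is a box with null sides; in dimension 0 it would carry the whole mass. *)
Lemma ae_neq0 : (1 <= N)%N -> \forall x \ae mu, x <> 0%R.
Proof.
move=> N1; exists [set x : 'rV[R]_N | forall i, [set 0%R] (x ord0 i)]; split.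
- rewrite [X in measurable X](_ : _ = \bigcap_(i in [set: 'I_N])
      ((fun x : 'rV[R]_N => x ord0 i) @^-1` [set 0%R])); last first.
    by apply/seteqP; split => x /= h i => [_|]; exact: h.
  apply: fin_bigcap_measurable => // i _.
  by rewrite -[X in measurable X]setTI; exact: measurable_coord.
- transitivity (\prod_(i < N) @lebesgue_measure R [set 0%R]).
    by apply: (@lebesgue_rV_box R N (fun=> [set 0%R])) => i; exact: measurable_set1.
  by case: N N1 => // k _; rewrite big_ord_recl lebesgue_measure_set1 mul0e.
by move=> x /contrapT -> i /=; rewrite mxE.
Qed.

Lemma measurable_truncation c f :
  measurable_fun [set: 'rV[R]_N] f ->
  measurable_fun [set: 'rV[R]_N] (fun y => if (c <= enorm y)%R then f y else 0).
Proof.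
move=> mf; apply: measurable_fun_ifT => //.
by apply: measurable_fun_ler => //; exact: measurable_enorm.
Qed.

(** Monotone convergence along the cut-off radii 1/(k+1); the condition f(0) = 0 gives convergence
    at the origin too. By contraposition, if the flow of f exceeds m on a non-null set, so does that
    of some truncation. *)
Lemma heat_truncation f (m : R) :
  measurable_fun [set: 'rV[R]_N] f -> (forall y, 0 <= f y) -> f 0%R = 0 ->
  (forall c, (0 < c)%R -> \forall x \ae mu,
    heat 1 (fun y => if (c <= enorm y)%R then f y else 0) x <= m%:E) ->
  \forall x \ae mu, heat 1 f x <= m%:E.
Proof.
move=> mf f0 f00 hm.
pose g k y := if (k.+1%:R^-1 <= enorm y)%R then f y else 0.
have {hm} : \forall x \ae mu, forall k, heat 1 (g k) x <= m%:E.
  by apply/ae_foralln => k; apply: hm; rewrite invr_gt0.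
apply: filterS => x hx.
have g0 k y : 0 <= g k y by rewrite /g; case: ifP.
have mg k : measurable_fun [set: 'rV[R]_N] (g k).
  exact: measurable_truncation.
pose G k y := (heat_kernel 1 (x - y))%:E * g k y.
have Glim y : limn (G ^~ y) = (heat_kernel 1 (x - y))%:E * f y.
  apply: lim_near_cst => //; rewrite /G /g.
  have [->|/eqP y0] := eqVneq y 0%R.
    by apply: nearW => k; rewrite f00; case: ifP.
  have e0 : (0 < enorm y)%R.
    by rewrite lt_def enorm_ge0 andbT; apply/eqP => /enorm_eq0.
  near=> k; rewrite ifT// ltW//; near: k.
  exact: near_infty_natSinv_lt (PosNum e0).
have -> : heat 1 f x = limn (fun k => heat 1 (g k) x).
  rewrite /heat -(@monotone_convergence _ _ _ mu setT measurableT G).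
  - by apply: eq_integral => y _; rewrite Glim.
  - by move=> k; exact: measurable_heat_integrand.
  - by move=> k y _; rewrite mule_ge0// lee_fin heat_kernel_ge0.
  move=> y _ j k jk; rewrite /G lee_wpmul2l// ?lee_fin ?heat_kernel_ge0//.
  rewrite /g; case: ifPn => [jy|_]; last by case: ifP.
  by rewrite ifT// (le_trans _ jy)// lef_pV2 ?posrE// ler_nat.
apply: lime_le; last by apply: nearW => k; exact: hx.
apply: ereal_nondecreasing_is_cvgn => j k jk; apply: le_heat => // y.
rewrite /g; case: ifPn => [jy|_]; last by case: ifP.
by rewrite ifT// (le_trans _ jy)// lef_pV2 ?posrE// ler_nat.
Unshelve. all: by end_near. Qed.

End heat_comparison.

(** * Upper bound for the existence time *)

Section existence_time.
Context {R : realType} {N : nat}.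
Local Notation mu := (@lebesgue_rV R N).
Local Notation leb := (@lebesgue_measure R).

(** With kap = 1/alpha - gamma/2 > 0 and b = alpha^(1/alpha) lambda m, the left side of the
    hypothesis is (b t^kap)^alpha; hence b t^kap <= 1. *)
Lemma powR_time_bound (alpha gamma lambda m t : R) :
  0 < alpha -> gamma < 2 / alpha -> 0 < lambda -> 0 < m -> 0 < t ->
  alpha * t * (lambda * t `^ (- (gamma / 2)) * m) `^ alpha <= 1 ->
  t <= (alpha `^ alpha^-1 * lambda * m) `^ (- (alpha^-1 - gamma / 2)^-1).
Proof.
move=> a0 ga l0 m0 t0.
set kap := alpha^-1 - gamma / 2; set b := alpha `^ alpha^-1 * lambda * m.
have kap0 : 0 < kap.
  by rewrite subr_gt0 ltr_pdivrMr// mulrC.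
have b0 : 0 < b by rewrite !mulr_gt0 ?powR_gt0.
have -> : alpha * t * (lambda * t `^ (- (gamma / 2)) * m) `^ alpha =
    (b * t `^ kap) `^ alpha.
  rewrite /b /kap powRD; last by apply/implyP => _; rewrite gt_eqF.
  rewrite [in RHS](_ : alpha `^ alpha^-1 * lambda * m * _ =
    (alpha `^ alpha^-1 * t `^ alpha^-1) * (lambda * t `^ (- (gamma / 2)) * m));
    last by ring.
  rewrite [RHS]powRM ?mulr_ge0 ?powR_ge0 ?(ltW l0) ?(ltW m0)//; congr (_ * _).
  rewrite -powRM ?(ltW a0) ?(ltW t0)// -powRrM mulVf ?gt_eqF// powRr1//.
  by rewrite mulr_ge0// ltW.
move=> h.
have {h} bt : b * t `^ kap <= 1.
  rewrite leNgt; apply/negP => bt1; move: h; rewrite leNgt => /negP; apply.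
  have := @gt0_ltr_powR R alpha a0 1 (b * t `^ kap).
  rewrite powR1; apply => //.
  - by rewrite nnegrE.
  - by rewrite nnegrE mulr_ge0 ?powR_ge0// ltW.
rewrite -[leLHS](powRr1 (ltW t0)) -[X in t `^ X](@divff _ kap) ?gt_eqF//.
rewrite -[in leRHS]mulN1r !powRrM powR_inv1 ?(ltW b0)//.
rewrite ge0_ler_powR ?invr_ge0 ?(ltW kap0)// ?nnegrE ?powR_ge0// ?invr_ge0 ?(ltW b0)//.
by rewrite -[leRHS]mul1r ler_pdivlMr// mulrC.
Qed.

Lemma ae_exists_itv (Q : R -> Prop) (a b : R) : a < b ->
  (\forall t \ae leb, Q t) -> exists2 t, a < t < b & Q t.
Proof.
move=> ab [A [mA A0 QA]]; apply: contrapT => nQ.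
have : (leb `]a, b[ <= leb A)%E.
  apply: le_measure; rewrite ?inE//.
  move=> t /=; rewrite in_itv/= => atb; apply: QA => Qt; apply: nQ; by exists t.
apply/negP; rewrite -ltNge A0 lebesgue_measure_itv/= lte_fin ab.
by rewrite -EFinB lte_fin subr_gt0.
Qed.

Variables (alpha gamma rho : R) (phi omega : 'rV[R]_N -> R).
Hypotheses (alpha0 : 0 < alpha) (gamma0 : 0 < gamma) (gamma_lt : gamma < 2 / alpha)
  (rho0 : 0 < rho)
  (mphi : measurable_fun [set: 'rV[R]_N] phi)
  (phi0 : \forall x \ae mu, 0 <= phi x)
  (momega : measurable_fun [set: 'rV[R]_N] omega)
  (omega_hom : homogeneous0 omega)
  (phi_ge : \forall x \ae mu,
       rho <= enorm x -> omega x * enorm x `^ (- gamma) <= phi x).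

(** The positive part secures the sign at every point and changes nothing almost everywhere when
    omega >= 0 almost everywhere. *)
Definition profile (y : 'rV[R]_N) : \bar R :=
  (Num.max (omega y) 0 * enorm y `^ (- gamma))%:E.

Lemma measurable_profile : measurable_fun [set: 'rV[R]_N] profile.
Proof.
apply/measurable_EFinP; apply: measurable_funM; first exact: measurable_maxr.
apply: (measurableT_comp (measurable_powR _)); exact: measurable_enorm.
Qed.

Lemma profile_ge0 y : (0 <= profile y)%E.
Proof. by rewrite lee_fin mulr_ge0 ?powR_ge0// le_max lexx orbT. Qed.

(** In [powR], 0 to a nonzero power is 0, negative exponents included; this is the value at the
    origin that [heat_truncation] asks for. *)
Lemma profile0 : profile 0 = 0%E.
Proof.
rewrite /profile (_ : enorm 0 = 0); last first.
  by rewrite /enorm big1 ?sqrtr0// => i _; rewrite mxE expr0n.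
by rewrite powR0 ?mulr0// oppr_eq0 gt_eqF.
Qed.

Let profile_trunc c y := if c <= enorm y then profile y else 0%E.

(** Here [t] is the square root of the time. For |y| >= c one has |t y| >= t c >= rho, so the lower
    bound on phi holds at t y, and homogeneity turns it into t^(-gamma) times the profile at y. *)
Lemma heat_data_ge (lambda c t : R) (x : 'rV[R]_N) :
  0 < lambda -> 0 < t -> rho <= t * c ->
  ((lambda * (t ^+ 2) `^ (- (gamma / 2)))%:E * heat 1 (profile_trunc c) x <=
   heat (t ^+ 2) (fun y => (lambda * phi y)%:E) (t *: x))%E.
Proof.
move=> l0 t0 tc.
pose v (y : 'rV[R]_N) : \bar R := (Num.max (lambda * phi y) 0)%:E.
have mlphi : measurable_fun [set: 'rV[R]_N] (fun y => lambda * phi y).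
  exact: measurable_funM.
have mv : measurable_fun [set: 'rV[R]_N] v.
  by apply/measurable_EFinP; exact: measurable_maxr.
have v0 y : (0 <= v y)%E by rewrite lee_fin le_max lexx orbT.
have -> : heat (t ^+ 2) (fun y => (lambda * phi y)%:E) (t *: x) =
    heat (t ^+ 2) v (t *: x).
  apply: ae_eq_heat => //; first exact/measurable_EFinP.
  by apply: filterS phi0 => y py; rewrite /v max_l// mulr_ge0// ltW.
rewrite (heat_scale x t0 mv v0).
have mpt := measurable_truncation c measurable_profile.
have pt0 y : (0 <= profile_trunc c y)%E.
  by rewrite /profile_trunc; case: ifP => // _; exact: profile_ge0.
rewrite -heatZ//; last by rewrite mulr_ge0 ?powR_ge0// ltW.
apply: ae_le_heat.
- exact: measurable_funeM.
- by apply: (measurableT_comp mv); exact: measurable_rVZ.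
- by move=> y; rewrite mule_ge0// lee_fin mulr_ge0 ?powR_ge0// ltW.
- by [].
apply: filterS3 (omega_hom t0) (ae_scale t0 phi_ge) (ae_scale t0 phi0) => y.
move=> om_t phi_t phi0_t; rewrite /profile_trunc /v.
case: ifPn => cy; last by rewrite mule0 lee_fin le_max lexx orbT.
rewrite /profile -EFinM lee_fin le_max; apply/orP; left.
rewrite -mulrA ler_pM2l//.
rewrite enormZ ?(ltW t0)// in phi_t.
have {}phi_t : omega y * (t * enorm y) `^ (- gamma) <= phi (t *: y).
  by rewrite -om_t; apply: phi_t; rewrite (le_trans tc)// ler_pM2l.
have -> : (t ^+ 2) `^ (- (gamma / 2)) = t `^ (- gamma).
  by rewrite -powR_mulrn ?(ltW t0)// -powRrM; congr (_ `^ _); field.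
rewrite mulrCA -powRM ?(ltW t0) ?enorm_ge0//.
have [om0|om0] := leP 0 (omega y); first exact: phi_t.
by rewrite mul0r.
Qed.

(** A solution living longer than the bound would satisfy the a priori estimate at some time t
    beyond it, and this keeps the truncated flow below m almost everywhere. *)
Lemma Tmax_le (lambda m c : R) : 0 < lambda -> 0 < m -> 0 < c ->
  ~ (\forall x \ae mu, heat 1 (profile_trunc c) x <= m%:E)%E ->
  (Tmax alpha (fun x => lambda * phi x)%R <=
   (Num.max ((rho / c) ^+ 2)
     ((alpha `^ alpha^-1 * lambda * m) `^ (- (alpha^-1 - gamma / 2)^-1)))%:E)%E.
Proof.
move=> l0 m0 c0 hm; set t0 := (rho / c) ^+ 2; set K := (X in Num.max _ X).
have t00 : 0 < t0 by rewrite exprn_gt0// divr_gt0.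
have b0 : 0 < Num.max t0 K by rewrite lt_max t00.
apply: ge_ereal_sup => _ [->|[T [T0 [u solu]] <-]]; first by rewrite lee_fin ltW.
rewrite lee_fin leNgt; apply/negP => bT.
have mlphi : measurable_fun [set: 'rV[R]_N] (fun y => lambda * phi y).
  exact: measurable_funM.
have lphi0 : \forall x \ae mu, 0 <= lambda * phi x.
  by apply: filterS phi0 => y py; rewrite mulr_ge0// ltW.
have /ae_product_measure bnd := solution_bound alpha0 mlphi lphi0 solu.
have [t /andP[bt tT] {}bnd] := ae_exists_itv bT bnd.
have t_gt0 := lt_trans b0 bt.
move: bt; rewrite gt_max => /andP[t0t Kt].
have s0 : 0 < Num.sqrt t by rewrite sqrtr_gt0.
have st : Num.sqrt t ^+ 2 = t by rewrite sqr_sqrtr// ltW.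
have stc : rho <= Num.sqrt t * c.
  rewrite -ler_pdivrMr// -(@ler_pXn2r _ 2)//; last 2 first.
  - by rewrite nnegrE ltW// divr_gt0.
  - by rewrite nnegrE ltW.
  by rewrite st ltW.
(* The estimate holds at almost every point, hence at sqrt(t) x for almost every x; a truncated flow
   above m at x would force t <= K. *)
apply: hm; apply: filterS (ae_scale s0 bnd) => x /=.
rewrite t_gt0 tT => /(_ isT) bx; rewrite leNgt; apply/negP => mx.
have := heat_data_ge x l0 s0 stc; rewrite st => hge.
have : t <= K; last by rewrite leNgt Kt.
apply: powR_time_bound => //.
set q := lambda * t `^ (- (gamma / 2)).
have q0 : 0 < q by rewrite mulr_gt0 ?powR_gt0.
have qm : ((q * m)%:E <=
    heat t (EFin \o (fun y => lambda * phi y)%R) (Num.sqrt t *: x))%E.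
  by apply: le_trans hge; rewrite EFinM lee_pmul2l// ltW.
rewrite -lee_fin; apply: le_trans bx.
rewrite EFinM lee_pmul2l ?lte_fin ?mulr_gt0// -poweR_EFin.
apply: gt0_ler_poweR; rewrite ?(ltW alpha0)//.
- by rewrite in_itv/= leey lee_fin mulr_ge0// ltW.
- by rewrite in_itv/= leey andbT (le_trans _ qm)// lee_fin mulr_ge0// ltW.
Qed.

End existence_time.

(** * Finiteness of the existence time and the limit superior *)

Theorem theorem1p9 (R : realType) (N : nat) (hN : (1 <= N)%N)
    (alpha : R) (halpha : 0 < alpha)
    (phi : 'rV[R]_N -> R) (hphi : locally_integrable_rV phi)
    (hphi0 : \forall x \ae lebesgue_rV N, 0 <= phi x)
    (omega : 'rV[R]_N -> R)
    (homega : measurable_fun [set: 'rV[R]_N] omega)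
    (homega_bnd : ('N[lebesgue_rV N]_+oo [EFin \o omega] < +oo)%E)
    (homega_hom : homogeneous0 omega)
    (homega0 : \forall x \ae lebesgue_rV N, 0 <= omega x)
    (homega_neq0 : ~ (\forall x \ae lebesgue_rV N, omega x = 0))
    (gamma rho : R) (hrho : 0 < rho)
    (hphi_ge : \forall x \ae lebesgue_rV N,
       rho <= enorm x -> omega x * enorm x `^ (- gamma) <= phi x)
    (hgamma0 : 0 < gamma) (hgammaN : gamma < N%:R)
    (hgamma : gamma < 2 / alpha) :
  let beta := (alpha^-1 - gamma / 2)^-1 in
  (forall lambda : R, 0 < lambda ->
     (Tmax alpha (fun x => lambda * phi x)%R < +oo)%E) /\
  (limf_esup (fun lambda : R =>
       (lambda `^ beta)%:E * Tmax alpha (fun x => lambda * phi x)%R)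
     (0^'+)
   <= (((alpha `^ alpha^-1)%:E *
        'N[lebesgue_rV N]_+oo [heat 1 (fun y =>
            (omega y * enorm y `^ (- gamma))%R%:E)]) `^ beta)^-1)%E.
Proof.
move=> beta; set kap := alpha^-1 - gamma / 2 in beta *.
set mu := lebesgue_rV N.
have kap0 : 0 < kap by rewrite subr_gt0 ltr_pdivrMr// mulrC.
have beta0 : 0 < beta by rewrite invr_gt0.
have a0 : 0 < alpha `^ alpha^-1 by rewrite powR_gt0.
set a := alpha `^ alpha^-1 in a0 *.
set f := (fun y => (omega y * enorm y `^ (- gamma))%:E).
set M := Lnorm _ _ _.
pose prof := profile gamma omega.
have mprof : measurable_fun [set: 'rV[R]_N] prof by exact: measurable_profile.
have prof0 y : (0 <= prof y)%E by exact: profile_ge0.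
have fprof : \forall y \ae mu, f y = prof y.
  by apply: filterS homega0 => y om0; rewrite /f /prof /profile max_l.
have mf : measurable_fun [set: 'rV[R]_N] f.
  apply/measurable_EFinP; apply: measurable_funM => //.
  apply: (measurableT_comp (measurable_powR _)); exact: measurable_enorm.
have hfE x : heat 1 f x = heat 1 prof x by exact: ae_eq_heat.
have muT0 : (0 < mu setT)%E by exact: lebesgue_rVT_gt0.
(* The norm of exponent +oo is the essential supremum only if the space has positive measure, and 0
   by default. *)
have ME : M = ess_sup mu (abse \o heat 1 f) by rewrite /M Lnorm.unlock muT0.
have M_le m : (\forall x \ae mu, heat 1 prof x <= m%:E)%E -> (M <= m%:E)%E.
  move=> hm; rewrite ME; apply/ess_supP; apply: filterS hm => x hx /=.
  by rewrite hfE gee0_abs//; exact: heat_ge0.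
(* If M = 0, the flow of the profile vanishes at some point, so the profile is null almost
   everywhere; away from the origin this forces omega = 0. *)
have M_gt0 : (0 < M)%E.
  rewrite lt0e Lnorm_ge0 andbT; apply/eqP => M0.
  have /ess_supP : (ess_sup mu (abse \o heat 1 f) <= 0)%E by rewrite -ME M0.
  have FF : ProperFilter (almost_everywhere mu).
    exact: ae_properfilter_algebraOfSetsType.
  move=> /filter_ex[x /=]; rewrite hfE gee0_abs; last exact: heat_ge0.
  move=> hx; have {hx} : heat 1 prof x = 0%E.
    by apply/eqP; rewrite eq_le hx; exact: heat_ge0.
  move/(heat_eq0 ltr01 mprof prof0) => hprof; apply: homega_neq0.
  apply: filterS3 hprof homega0 (ae_neq0 hN) => y.
  rewrite /prof /profile => -[py] om0 y0; move/eqP: py.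
  rewrite max_l// mulf_eq0 => /orP[/eqP//|].
  by rewrite powR_eq0 => /andP[/eqP /enorm_eq0].
(* The threshold t0 does not depend on lambda, so lambda^beta t0 tends to 0 with lambda. *)
have key m : 0 < m -> (m%:E < M)%E -> exists2 t0, 0 < t0 &
    forall lambda, 0 < lambda ->
    (Tmax alpha (fun x => lambda * phi x)%R <=
      (Num.max t0 ((a * lambda * m) `^ (- beta)))%:E)%E.
  move=> m0 mM.
  have [c c0 hc] : exists2 c, 0 < c & ~ (\forall x \ae mu,
      heat 1 (fun y => if (c <= enorm y)%R then prof y else 0) x <= m%:E)%E.
    apply: contrapT => nc; move: mM; rewrite ltNge => /negP; apply.
    apply/M_le/heat_truncation => //; first exact: profile0.
    by move=> c c0; apply: contrapT => hc; apply: nc; exists c.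
  exists ((rho / c) ^+ 2); first by rewrite exprn_gt0// divr_gt0.
  by move=> lambda l0; exact: (Tmax_le halpha hgamma hrho hphi.1 hphi0
    homega homega_hom hphi_ge l0 m0 c0 hc).
split.
  move=> lambda l0.
  have [m m0 mM] : exists2 m, 0 < m & (m%:E < M)%E.
    move: M_gt0; case: (M) => [r|_|//].
      rewrite lte_fin => r0; exists (r / 2); first by rewrite divr_gt0.
      by rewrite lte_fin ltr_pdivrMr// ltr_pMr// ltr1n.
    by exists 1 => //; rewrite ltry.
  have [t0 _ /(_ _ l0) Tle] := key _ m0 mM.
  by rewrite (le_lt_trans Tle)// ltry.
set RHS := (X in (_ <= X)%E).
have RHS0 : (0 <= RHS)%E by rewrite inve_ge0 poweR_ge0.
suff main r : (RHS < r%:E)%E -> (limf_esup (fun lambda : R =>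
    (lambda `^ beta)%:E * Tmax alpha (fun x => lambda * phi x)%R) 0^'+ <= r%:E)%E.
  move: RHS0 main; case: RHS => [r0|_ _|//]; last by rewrite leey.
  move=> _ main; apply/lee_addgt0Pr => e e0.
  by rewrite -EFinD; apply: main; rewrite lte_fin ltrDl.
move=> rRHS.
have r0 : 0 < r by rewrite -lte_fin (le_lt_trans RHS0).
(* Chosen so that (a m)^(-beta) = r; then r > [RHS] amounts to m < M. *)
pose m := r `^ (- kap) / a.
have m0 : 0 < m by rewrite divr_gt0// powR_gt0.
have amr : (a * m) `^ (- beta) = r.
  rewrite /m mulrCA divff ?gt_eqF// mulr1 -powRrM mulrNN divff ?gt_eqF//.
  by rewrite powRr1// ltW.
have mM : (m%:E < M)%E.
  rewrite ltNge; apply/negP => Mm.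
  move: rRHS; rewrite ltNge => /negP; apply; rewrite /RHS.
  have Mfin : M \is a fin_num.
    by rewrite ge0_fin_numE ?(ltW M_gt0)// (le_lt_trans Mm)// ltry.
  move: Mm M_gt0; rewrite -(fineK Mfin) lee_fin lte_fin => Mm M0.
  have am0 : 0 < a * m by rewrite mulr_gt0.
  have aM0 : 0 < a * fine M by rewrite mulr_gt0.
  rewrite -EFinM poweR_EFin inver gt_eqF ?powR_gt0// lee_fin -powRN -amr.
  rewrite !powRN lef_pV2 ?posrE ?powR_gt0// ?mulr_gt0//.
  by rewrite ge0_ler_powR ?nnegrE ?(ltW beta0) ?(ltW aM0) ?(ltW am0)// ler_pM2l.
have [t0 t00 Tle] := key _ m0 mM.
set F := (X in limf_esup X _); apply: ereal_inf_le.
(* The limit superior is an infimum over neighbourhoods; since beta > 0, this set is a right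
   neighbourhood of 0. *)
exists (ereal_sup (F @` [set lambda : R | 0 < lambda /\ lambda `^ beta * t0 <= r])).
  exists [set lambda : R | 0 < lambda /\ lambda `^ beta * t0 <= r] => //.
  near=> lambda; split => //.
  rewrite -ler_pdivlMr//; near: lambda.
  have /cvgrPdist_le /(_ (r / t0)) := powR_cvg0 beta0.
  move=> /(_ (divr_gt0 r0 t00)); apply: filterS => l.
  by rewrite sub0r normrN ger0_norm// powR_ge0.
apply: ge_ereal_sup => _ [lambda [l0 lr] <-].
apply: (@le_trans _ _ ((lambda `^ beta)%:E *
    (Num.max t0 ((a * lambda * m) `^ (- beta)))%:E)%E).
  by rewrite lee_wpmul2l ?Tle// lee_fin powR_ge0.
(* Multiplied by lambda^beta, the first entry of the maximum is at most r by the choice of the set,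
   and the second equals r. *)
rewrite -EFinM lee_fin maxr_pMr ?powR_ge0// ge_max lr /=.
rewrite [a * lambda]mulrC -mulrA (powRM _ (ltW l0) (ltW (mulr_gt0 a0 m0))).
by rewrite amr powRN mulrA divff ?mul1r// gt_eqF// powR_gt0.
Unshelve. all: by end_near. Qed.
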